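(* The minimal DSF triples are exactly the following ten sets: $\{K_3,K_{1,3},2K_2\}$, $\{K_3,K_{1,3},P_3+K_1\}$, $\{K_3,K_{2,3},P_3+K_1\}$, $\{K_3,C_4,P_3+K_1\}$, $\{K_3+K_1,C_4,P_3+K_1\}$, $\{3K_1,K_1+K_3,C_4\}$, $\{3K_1,K_1+K_3,\mathrm{paw}\}$, $\{3K_1,K_2+K_3,\mathrm{paw}\}$, $\{3K_1,2K_2,\mathrm{paw}\}$, $\{K_{1,3},2K_2,\mathrm{paw}\}$.
   Context: All graphs are finite and simple, considered up to isomorphism. $K_n$, $P_n$, $C_n$ denote the complete graph, path and cycle on $n$ vertices, $K_{m,n}$ the complete bipartite graph with parts of sizes $m,n$, $G+H$ the disjoint union and $mG$ the disjoint union of $m$ copies of $G$. The paw is the complement of $P_3+K_1$ (a triangle with a pendant vertex). For a set $\mathcal{F}$ of graphs, a graph is $\mathcal{F}$-free if none of its induced subgraphs is isomorphic to a member of $\mathcal{F}$. A set $\mathcal{F}$ of graphs is degree-sequence-forcing (DSF) if whenever some realization of a degree sequence $d$ (a graph with degree sequence $d$) is $\mathcal{F}$-free, every realization of $d$ is $\mathcal{F}$-free. A DSF set is minimal if no proper subset of it is DSF; a minimal DSF triple is a minimal DSF set with exactly three elements.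
   Formalization: Minimality is read as ''no nonempty proper subset is DSF'': the empty set is vacuously DSF (every graph is free of it) and is a proper subset of every triple, so under the literal definition no triple would be minimal. *)

(* Defs.v *)
From mathcomp Require Import all_boot.

Set Implicit Arguments.
Unset Strict Implicit.
Unset Printing Implicit Defensive.

Record sgraph := SGraph {
  svertex :> finType;
  sedge : rel svertex;
  sedge_sym : symmetric sedge;
  sedge_irr : irreflexive sedge }.

Definition iso (G H : sgraph) : Prop :=
  exists2 f : G -> H, bijective f &
    forall x y : G, sedge (f x) (f y) = sedge x y.

Section Induced.
Variables (G : sgraph) (S : {set G}).

Definition induced_edge : rel {x : G | x \in S} :=
  fun u v => sedge (val u) (val v).

Lemma induced_sym : symmetric induced_edge.
Proof. by move=> u v; rewrite /induced_edge sedge_sym. Qed.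

Lemma induced_irr : irreflexive induced_edge.
Proof. by move=> u; rewrite /induced_edge sedge_irr. Qed.

Definition induced : sgraph := SGraph induced_sym induced_irr.
End Induced.

Section Complete.
Variable n : nat.

Definition K_edge : rel 'I_n := fun i j => i != j.

Lemma K_sym : symmetric K_edge.
Proof. by move=> i j; rewrite /K_edge eq_sym. Qed.

Lemma K_irr : irreflexive K_edge.
Proof. by move=> i; rewrite /K_edge eqxx. Qed.

Definition K : sgraph := SGraph K_sym K_irr.
End Complete.

Section Path.
Variable n : nat.

Definition P_edge : rel 'I_n := fun i j => (i.+1 == j) || (j.+1 == i).

Lemma P_sym : symmetric P_edge.
Proof. by move=> i j; rewrite /P_edge orbC. Qed.

Lemma P_irr : irreflexive P_edge.
Proof. by move=> i; rewrite /P_edge eqn_leq ltnn. Qed.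

Definition P : sgraph := SGraph P_sym P_irr.
End Path.

(* The cycle is only meaningful for n >= 3; the conjunct [i != j] merely
   avoids a loop when n = 1. *)
Section Cycle.
Variable n : nat.

Definition C_edge : rel 'I_n := fun i j =>
  (i != j) && ((i.+1 %% n == j) || (j.+1 %% n == i)).

Lemma C_sym : symmetric C_edge.
Proof. by move=> i j; rewrite /C_edge eq_sym orbC. Qed.

Lemma C_irr : irreflexive C_edge.
Proof. by move=> i; rewrite /C_edge eqxx. Qed.

Definition C : sgraph := SGraph C_sym C_irr.
End Cycle.

Section CompleteBipartite.
Variables m n : nat.

Definition KB_edge : rel ('I_m + 'I_n) := fun u v =>
  match u, v with
  | inl _, inr _ | inr _, inl _ => true
  | _, _ => false
  end.

Lemma KB_sym : symmetric KB_edge.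
Proof. by case=> i; case. Qed.

Lemma KB_irr : irreflexive KB_edge.
Proof. by case. Qed.

Definition KB : sgraph := SGraph KB_sym KB_irr.
End CompleteBipartite.

Section DisjointUnion.
Variables G H : sgraph.

Definition union_edge : rel (G + H) := fun u v =>
  match u, v with
  | inl x, inl y => sedge x y
  | inr x, inr y => sedge x y
  | _, _ => false
  end.

Lemma union_sym : symmetric union_edge.
Proof. by case=> x; case=> y //=; exact: sedge_sym. Qed.

Lemma union_irr : irreflexive union_edge.
Proof. by case=> x /=; exact: sedge_irr. Qed.

Definition disjoint_union : sgraph := SGraph union_sym union_irr.
End DisjointUnion.

Section Copies.
Variables (m : nat) (G : sgraph).

Definition copies_edge : rel ('I_m * G) := fun u v =>
  (u.1 == v.1) && sedge u.2 v.2.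

Lemma copies_sym : symmetric copies_edge.
Proof. by move=> u v; rewrite /copies_edge eq_sym sedge_sym. Qed.

Lemma copies_irr : irreflexive copies_edge.
Proof. by move=> u; rewrite /copies_edge sedge_irr andbF. Qed.

Definition copies : sgraph := SGraph copies_sym copies_irr.
End Copies.

Section Complement.
Variable G : sgraph.

Definition compl_edge : rel G := fun x y => (x != y) && ~~ sedge x y.

Lemma compl_sym : symmetric compl_edge.
Proof. by move=> x y; rewrite /compl_edge eq_sym sedge_sym. Qed.

Lemma compl_irr : irreflexive compl_edge.
Proof. by move=> x; rewrite /compl_edge eqxx. Qed.

Definition complement : sgraph := SGraph compl_sym compl_irr.
End Complement.

Declare Scope graph_scope.
Delimit Scope graph_scope with G.
Bind Scope graph_scope with sgraph.
Notation "G + H" := (disjoint_union G H) : graph_scope.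
Notation "m * G" := (copies m%N G) : graph_scope.

Definition paw : sgraph := complement (P 3 + K 1)%G.

Definition degree (G : sgraph) (x : G) : nat := #|[set y : G | sedge x y]|.

(* Nonincreasing list of the vertex degrees, with multiplicities. *)
Definition degree_sequence (G : sgraph) : seq nat :=
  sort geq [seq degree x | x : G].

Definition realizes (G : sgraph) (d : seq nat) : Prop := degree_sequence G = d.

(* Graphs are considered up to isomorphism, so a set of graphs is an
   isomorphism-invariant predicate, i.e. a set of isomorphism classes. *)
Record graph_set := GraphSet {
  in_gset :> sgraph -> Prop;
  gset_iso : forall G H : sgraph, iso G H -> in_gset G -> in_gset H }.

Definition gset_sub (F1 F2 : graph_set) : Prop :=
  forall G : sgraph, F1 G -> F2 G.

Definition gset_eq (F1 F2 : graph_set) : Prop :=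
  forall G : sgraph, F1 G <-> F2 G.

Definition gset_proper (F1 F2 : graph_set) : Prop :=
  gset_sub F1 F2 /\ ~ gset_sub F2 F1.

Definition gset_nonempty (F : graph_set) : Prop := exists G : sgraph, F G.

Lemma iso_trans (G1 G2 G3 : sgraph) : iso G1 G2 -> iso G2 G3 -> iso G1 G3.
Proof.
move=> [f bij_f fE] [g bij_g gE].
exists (g \o f); first exact: bij_comp.
by move=> x y; rewrite /= gE fE.
Qed.

Lemma iso_sym (G H : sgraph) : iso G H -> iso H G.
Proof.
move=> [f [g fK gK] fE]; exists g; first by exists f.
by move=> x y; rewrite -fE !gK.
Qed.

Lemma triple_iso (A B C G H : sgraph) : iso G H ->
  [\/ iso G A, iso G B | iso G C] -> [\/ iso H A, iso H B | iso H C].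
Proof.
move=> /iso_sym isoHG [] isoG; [constructor 1|constructor 2|constructor 3];
  exact: iso_trans isoHG isoG.
Qed.

Definition triple (A B C : sgraph) : graph_set :=
  GraphSet (@triple_iso A B C).

Definition has_three_elements (F : graph_set) : Prop :=
  exists A B C : sgraph,
    [/\ ~ iso A B, ~ iso A C, ~ iso B C & gset_eq F (triple A B C)].

Definition free (F : graph_set) (G : sgraph) : Prop :=
  forall (S : {set G}) (H : sgraph), F H -> ~ iso (induced S) H.

Definition DSF (F : graph_set) : Prop :=
  forall d : seq nat,
    (exists G : sgraph, realizes G d /\ free F G) ->
    forall G : sgraph, realizes G d -> free F G.

(* The empty set vacuously satisfies [DSF], so minimality quantifies over
   nonempty proper subsets; otherwise no nonempty set would be minimal. *)
Definition minimal_DSF (F : graph_set) : Prop :=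
  DSF F /\
  forall F' : graph_set, gset_nonempty F' -> gset_proper F' F -> ~ DSF F'.

Definition minimal_DSF_triple (F : graph_set) : Prop :=
  minimal_DSF F /\ has_three_elements F.

(* Main.v *)
Require Import Defs.
From mathcomp Require Import all_boot.
From Stdlib Require Import Classical.

(* Two realizations of a degree sequence are connected by 2-switches, so a set
   F is degree-sequence-forcing iff F-freeness is preserved by switches. A switch
   creating a copy of a member of F meets that copy in at least two vertices, so
   for a finite F this is a finite check, which settles the ten triples.

   Conversely, comparing suitable realizations shows that every such F contains
   a forest of stars, a complete bipartite (or edgeless) graph, and complements
   of such graphs. In a triple some member lies in two of these four families.
   Either it is one of four small graphs, or up to complementation it is a clique
   plus at most one isolated vertex; replacing an edge of that clique by two
   pendant edges then forces another member of F to be small. From each of these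
   finitely many starting points, a switch from a graph free of the known members
   of F to a graph that is not forces F to contain an induced subgraph of the
   former; branching twice determines the triple. *)

Set Implicit Arguments.
Unset Strict Implicit.
Unset Printing Implicit Defensive.

(** * Induced embeddings *)

(** The clique case is the obstacle. A graph lying in one of the first two families and in the
    complement of one of them has at most four vertices, but stars and edgeless graphs lie in both
    of the first two and have any size. Even after an edge of the complementary clique has been
    moved, the member W found this way may still contain a large clique, and a second pigeonhole
    bounds it. If W is neither a star forest nor a biclique, then the clique and W are two members
    outside these families, so the third member lies in both of them. The same construction applied
    to the complement of that third member yields a member different from it, hence one of the first
    two. Every outcome leaves at most four unlabelled clique vertices, and this is where the nine
    vertices of [base] come from. *)

Definition emb (A B : sgraph) : Prop :=
  exists2 f : A -> B, injective f & forall x y, sedge (f x) (f y) = sedge x y.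

Lemma emb_trans A B D : emb A B -> emb B D -> emb A D.
Proof.
move=> [f f_inj fE] [g g_inj gE]; exists (g \o f); first exact: inj_comp.
by move=> x y; rewrite /= gE fE.
Qed.

Lemma iso_emb A B : iso A B -> emb A B.
Proof. by case=> f /bij_inj f_inj fE; exists f. Qed.

Lemma iso_refl A : iso A A.
Proof. by exists id => //; exists id. Qed.

Lemma emb_iso A B : emb A B -> #|B| <= #|A| -> iso A B.
Proof. by case=> f f_inj fE le_BA; exists f => //; apply: inj_card_bij. Qed.

Lemma iso_card A B : iso A B -> #|A| = #|B|.
Proof. by case=> f /bij_eq_card. Qed.

Lemma emb_induced G H : emb H G <-> exists S : {set G}, iso (induced S) H.
Proof.
split=> [[f f_inj fE]|[S /iso_sym/iso_emb [f f_inj fE]]]; last first.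
  by exists (val \o f) => [|x y]; [apply: inj_comp val_inj f_inj | rewrite -fE].
exists (f @: [set: H]); apply/iso_sym/emb_iso.
  have fS x : f x \in f @: [set: H] by rewrite imset_f.
  by exists (fun x => exist _ (f x) (fS x)) => [x y [] /f_inj|].
by rewrite card_sig card_imset ?cardsT.
Qed.

Lemma freeE F G : free F G <-> forall H, F H -> ~ emb H G.
Proof.
split=> [fr H FH /emb_induced [S isoS]|fr S H FH isoS]; first exact: fr isoS.
by apply: fr FH _; apply/emb_induced; exists S.
Qed.

Lemma free_emb F G H : emb H G -> free F G -> free F H.
Proof.
move=> HG /freeE frG; apply/freeE => A FA AH.
by apply: frG FA _; apply: emb_trans HG.
Qed.

Lemma not_free F G : ~ free F G -> exists2 W, F W & emb W G.
Proof.
move=> nfr; apply: NNPP => no; apply/nfr/freeE => H FH HG.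
by apply: no; exists H.
Qed.

Lemma complement_emb A B : emb A B -> emb (complement A) (complement B).
Proof.
case=> f f_inj fE; exists f => // x y.
by rewrite /= /compl_edge fE (inj_eq f_inj).
Qed.

Lemma complement_iso A B : iso A B -> iso (complement A) (complement B).
Proof.
case=> f f_bij fE; exists f => // x y.
by rewrite /= /compl_edge fE (inj_eq (bij_inj f_bij)).
Qed.

Lemma complementK A : iso (complement (complement A)) A.
Proof.
exists id; first by exists id.
move=> x y; rewrite /= /compl_edge /= /compl_edge.
by case: eqVneq => [->|_]; rewrite ?sedge_irr //= negbK.
Qed.

Lemma compl_set_iso (F : graph_set) G H :
  iso G H -> F (complement G) -> F (complement H).
Proof. by move=> /complement_iso GH; apply: (gset_iso GH). Qed.

Definition compl_set (F : graph_set) : graph_set :=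
  GraphSet (@compl_set_iso F).

Lemma compl_setP F G : compl_set F (complement G) <-> F G.
Proof.
split=> FG; first exact: (gset_iso (complementK G) FG).
exact: (gset_iso (iso_sym (complementK G)) FG).
Qed.

(** * Degree sequences *)

Lemma geq_total : total geq. Proof. by move=> m n; apply: leq_total. Qed.
Lemma geq_trans : transitive geq. Proof. by move=> m n p /[swap]; apply: leq_trans. Qed.
Lemma geq_anti : antisymmetric geq.
Proof. by move=> m n; rewrite andbC => /anti_leq. Qed.

(** Both vertex sets are sorted by degree and vertices at equal positions are matched. This puts two
    realizations on one vertex set, where their edges can be compared. *)
Lemma degree_seq_bij G H : degree_sequence G = degree_sequence H ->
  exists2 f : G -> H, bijective f & forall x, degree (f x) = degree x.
Proof.
have E K : degree_sequence K
         = map (@degree K) (sort (relpre (@degree K) geq) (enum K)).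
  by rewrite -sort_map.
rewrite !E {E}.
set s := sort _ (enum G); set t := sort _ (enum H) => st.
have s_uniq : uniq s by rewrite sort_uniq enum_uniq.
have t_uniq : uniq t by rewrite sort_uniq enum_uniq.
have in_s x : x \in s by rewrite mem_sort mem_enum.
have in_t x : x \in t by rewrite mem_sort mem_enum.
have sz : size s = size t by rewrite -(size_map (@degree G)) st size_map.
have ex x : exists y, (index y t == index x s) && (degree y == degree x).
  have lt_x : index x s < size t by rewrite -sz index_mem.
  have y0 : H by case: (t) lt_x => // y.
  exists (nth y0 t (index x s)); rewrite index_uniq // eqxx -(nth_map _ 0) //.
  by rewrite -st (nth_map x) ?index_mem // nth_index ?eqxx.
have exP x := xchooseP (ex x).
exists (fun x => xchoose (ex x)) => [|x]; last by case/andP: (exP x) => _ /eqP.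
apply: inj_card_bij => [x y eq_xy|].
  have /andP[/eqP ix _] := exP x; have /andP[/eqP iy _] := exP y.
  rewrite eq_xy iy in ix; rewrite -(nth_index x (in_s x)) -(nth_index x (in_s y)).
  by rewrite ix.
by rewrite !cardE; move: sz; rewrite !size_sort => ->.
Qed.

Lemma bij_degree_seq (G H : sgraph) (f : G -> H) : bijective f ->
  (forall x, degree (f x) = degree x) -> degree_sequence G = degree_sequence H.
Proof.
move=> f_bij fE; apply/perm_sortP.
- exact: geq_total.
- exact: geq_trans.
- exact: geq_anti.
have -> : [seq degree x | x : G] = [seq degree y | y <- [seq f x | x : G]].
  by rewrite /image_mem -map_comp; apply: eq_map => x /=.
apply: perm_map; apply: uniq_perm.
- by rewrite map_inj_uniq ?enum_uniq //; apply: bij_inj.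
- exact: enum_uniq.
case: f_bij => g fK gK y; rewrite mem_enum -[y]gK.
by apply/mapP; exists (g y); rewrite ?mem_enum.
Qed.

Lemma DSF_degree F : DSF F <-> forall G H,
  degree_sequence G = degree_sequence H -> free F G -> free F H.
Proof.
split=> [dsfF G H GH frG|dsfF d [G [<- frG]] H /esym/dsfF]; last exact.
by apply: (dsfF (degree_sequence H)) => //; exists G.
Qed.

(** Were the second graph free of [F], the first would be too. Each pair of graphs with the same
    degree at every vertex thus becomes a source of further members of [F]. *)
Lemma DSF_find F (V : finType) (e1 e2 : rel V) s1 i1 s2 i2 X :
    DSF F -> F X -> emb X (@SGraph V e1 s1 i1) ->
    (forall x, #|[set y | e1 x y]| = #|[set y | e2 x y]|) ->
  exists2 W, F W & emb W (@SGraph V e2 s2 i2).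
Proof.
move=> /DSF_degree dsfF FX Xe deg12; apply: not_free => /dsfF fr2.
suff /freeE/(_ X FX) : free F (@SGraph V e1 s1 i1) by [].
apply: fr2; apply: (@bij_degree_seq (SGraph s2 i2) (SGraph s1 i1) id) => [|x].
  by exists id.
by rewrite /degree /= deg12.
Qed.

Lemma degree_complement (G : sgraph) (x : complement G) :
  degree x = #|G|.-1 - @degree G x.
Proof.
have -> : degree x = #|~: (x |: [set y : G | @sedge G x y])|.
  rewrite /degree; apply: eq_card => y.
  by rewrite !inE /= /compl_edge negb_or eq_sym.
rewrite cardsCs setCK cardsU1 inE sedge_irr /= add1n.
by rewrite -subn1 -subnDA add1n.
Qed.

(** Complementation turns degree k into n - 1 - k, so it respects equality of degree sequences.
    Every necessary condition on [F] then comes with its complementary one. *)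
Lemma DSF_compl F : DSF F -> DSF (compl_set F).
Proof.
move=> /DSF_degree dsfF; apply/DSF_degree => G H GH.
have compl_free K : free (compl_set F) K <-> free F (complement K).
  split=> /freeE fr; apply/freeE => A FA AK.
    apply: (fr (complement A)); first exact/compl_setP.
    by apply: emb_trans (complement_emb AK) _; apply/iso_emb/complementK.
  by apply: fr FA _; apply: complement_emb.
move=> /compl_free frG; apply/compl_free; apply: dsfF frG.
have [f f_bij fE] := degree_seq_bij GH.
apply: (@bij_degree_seq (complement G) (complement H) f) => // x.
by rewrite !degree_complement fE (bij_eq_card f_bij).
Qed.

(** * Two-switches *)

Definition same_pair (T : eqType) (p q x y : T) :=
  (x == p) && (y == q) || (x == q) && (y == p).

Definition on_cycle (T : eqType) (a b c d x y : T) :=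
  [|| same_pair a b x y, same_pair b c x y, same_pair c d x y
    | same_pair d a x y].

Lemma on_cycle_sym (T : eqType) (a b c d x y : T) :
  on_cycle a b c d x y = on_cycle a b c d y x.
Proof.
have sym p q : same_pair p q x y = same_pair p q y x.
  by rewrite /same_pair orbC; congr (_ || _); apply: andbC.
by rewrite /on_cycle !sym.
Qed.

Lemma on_cycle_rot (T : eqType) (a b c d x y : T) :
  on_cycle b c d a x y = on_cycle a b c d x y.
Proof. by rewrite /on_cycle [RHS]orbC -!orbA. Qed.

Section Switch.
Variables (G : sgraph) (a b c d : G).

(** Toggling the four sides of the cycle, rather than deleting and adding edges, makes undoing a
    switch a cancellation of exclusive ors. The guard [x != y] gives irreflexivity for arbitrary
    [a], [b], [c], [d]; [switchE] removes it for legal switches. *)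
Definition switch_edge : rel G :=
  fun x y => (x != y) && (sedge x y (+) on_cycle a b c d x y).

Lemma switch_sym : symmetric switch_edge.
Proof.
by move=> x y; rewrite /switch_edge eq_sym sedge_sym on_cycle_sym.
Qed.

Lemma switch_irr : irreflexive switch_edge.
Proof. by move=> x; rewrite /switch_edge eqxx. Qed.

Definition switch : sgraph := SGraph switch_sym switch_irr.

Definition switchable :=
  [&& sedge a b, sedge c d, ~~ sedge b c, ~~ sedge d a, b != c & d != a].

End Switch.

Lemma switchable_uniq (G : sgraph) (a b c d : G) :
  switchable a b c d -> uniq [:: a; b; c; d].
Proof.
case/and5P=> ab cd bc da /andP[b'c d'a]; rewrite /= !inE !negb_or b'c.
have -> : a != b by apply: contraTneq ab => ->; rewrite sedge_irr.
have -> : c != d by apply: contraTneq cd => ->; rewrite sedge_irr.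
have -> : a != c by apply: contraTneq ab => ->; rewrite sedge_sym.
have -> : b != d by apply: contraTneq ab => ->; rewrite sedge_sym.
by rewrite eq_sym d'a.
Qed.

Lemma on_cycle_neq (G : sgraph) (a b c d x y : G) :
  switchable a b c d -> on_cycle a b c d x y -> x != y.
Proof.
move/switchable_uniq; rewrite /= !inE !negb_or.
case/and4P=> /and3P[ab ac ad] /andP[bc bd] cd _.
by case/or4P=> /orP[] /andP[/eqP-> /eqP->] //; rewrite eq_sym.
Qed.

Lemma switchE (G : sgraph) (a b c d x y : G) : switchable a b c d ->
  @sedge (switch a b c d) x y = @sedge G x y (+) on_cycle a b c d x y.
Proof.
move=> sw; rewrite /= /switch_edge; case: eqVneq => //= <-.
by rewrite sedge_irr; apply/esym/negP => /(on_cycle_neq sw); rewrite eqxx.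
Qed.

(** Edges and non-edges of the 4-cycle have traded places, so the cycle read from its next vertex is
    switchable again; that switch is the inverse one. *)
Lemma switchable_switch (G : sgraph) (a b c d : G) : switchable a b c d ->
  @switchable (switch a b c d) b c d a.
Proof.
move=> sw; have := switchable_uniq sw; rewrite /= !inE !negb_or.
case/and4P=> /and3P[ab ac ad] /andP[bc bd] cd _.
case/and5P: (sw) => Eab Ecd Ebc Eda _; rewrite /switchable !switchE //.
rewrite Eab (negbTE Ebc) Ecd (negbTE Eda).
by rewrite /on_cycle /same_pair !eqxx /= !orbT /= cd ab.
Qed.

Lemma switchK (G : sgraph) (a b c d : G) : switchable a b c d ->
  iso (@switch (switch a b c d) b c d a) G.
Proof.
move=> sw; exists id; first by exists id.
move=> x y; rewrite [RHS](switchE _ _ (switchable_switch sw)).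
have -> : @sedge (switch a b c d) x y = @sedge G x y (+) on_cycle a b c d x y.
  exact: switchE.
by rewrite [X in _ (+) X]on_cycle_rot addbK.
Qed.

Lemma card_swap (T : finType) (A B : {set T}) b d :
  b \in A -> d \notin A -> B = d |: (A :\ b) -> #|B| = #|A|.
Proof.
move=> bA dA ->; rewrite cardsU1 (cardsD1 b A) bA !inE (negbTE dA).
by rewrite andbF.
Qed.

Lemma switch_degree (G : sgraph) (a b c d x : G) : switchable a b c d ->
  @degree (switch a b c d) x = degree x.
Proof.
move=> sw; have := switchable_uniq sw; rewrite /= !inE !negb_or.
case/and4P=> /and3P[ab ac ad] /andP[bc bd] cd _.
case/and5P: (sw) => Eab Ecd Ebc Eda _.
have neqs := (negbTE ab, negbTE ac, negbTE ad, negbTE bc, negbTE bd, negbTE cd,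
              eq_sym b a, eq_sym c a, eq_sym d a, eq_sym c b, eq_sym d b,
              eq_sym d c).
have NE y : (y \in [set z | @sedge (switch a b c d) x z])
          = sedge x y (+) on_cycle a b c d x y by rewrite inE switchE.
rewrite /degree; set B := [set y | _] in NE *.
(* A vertex of the cycle loses the neighbour [p] and gains the neighbour [q]; the four cases below
   only supply these two. *)
have swap p q : sedge x p -> ~~ sedge x q ->
    (forall y, on_cycle a b c d x y = (y == p) || (y == q)) ->
    #|B| = #|[set y | sedge x y]|.
  move=> Exp Exq onE; apply: (@card_swap _ _ _ p q); rewrite ?inE //.
  apply/setP => y; rewrite NE onE !inE.
  have [->|_] := eqVneq y q; first by rewrite orbT (negbTE Exq).
  by have [->|_] := eqVneq y p; rewrite ?Exp // orbF addbF.
have [xa|xa] := eqVneq x a.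
  apply: (swap b d); rewrite ?xa // 1?sedge_sym //.
  by move=> y; rewrite /on_cycle /same_pair !neqs !eqxx /= !orbF.
have [xb|xb] := eqVneq x b.
  apply: (swap a c); rewrite ?xb // 1?sedge_sym //.
  by move=> y; rewrite /on_cycle /same_pair !neqs !eqxx /= !orbF.
have [xc|xc] := eqVneq x c.
  apply: (swap d b); rewrite ?xc // 1?sedge_sym //.
  by move=> y; rewrite /on_cycle /same_pair !neqs !eqxx /= !orbF orbC.
have [xd|xd] := eqVneq x d.
  apply: (swap c a); rewrite ?xd // 1?sedge_sym //.
  by move=> y; rewrite /on_cycle /same_pair !neqs !eqxx /= !orbF.
apply: eq_card => y; rewrite NE inE /on_cycle /same_pair.
by rewrite (negbTE xa) (negbTE xb) (negbTE xc) (negbTE xd) /= addbF.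
Qed.

(** * Reducing the symmetric difference of two realizations *)

Section SymmetricDifference.
Variables (V : finType) (e1 e2 : rel V).
Hypotheses (s1 : symmetric e1) (i1 : irreflexive e1).
Hypotheses (s2 : symmetric e2) (i2 : irreflexive e2).
Hypothesis deg12 : forall x, #|[set y | e1 x y]| = #|[set y | e2 x y]|.

Let red x y := e1 x y && ~~ e2 x y.
Let blue x y := e2 x y && ~~ e1 x y.
Let R x := [set y | red x y].
Let B x := [set y | blue x y].

Lemma red_sym x y : red x y = red y x.
Proof. by rewrite /red s1 s2. Qed.

Lemma blue_sym x y : blue x y = blue y x.
Proof. by rewrite /blue s1 s2. Qed.

Lemma card_red_blue x : #|R x| = #|B x|.
Proof.
have RE : R x = [set y | e1 x y] :\: [set y | e2 x y].
  by apply/setP => y; rewrite !inE andbC.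
have BE : B x = [set y | e2 x y] :\: [set y | e1 x y].
  by apply/setP => y; rewrite !inE andbC.
by rewrite RE BE !cardsD deg12 setIC.
Qed.

(* Otherwise let [v] have maximal red degree, [c] be a blue neighbour of [v] and
   [d] a red neighbour of [c]: then [c], [R v :\ d] and, if [d] is in [R v], also
   [v] lie in [R d], which is too many. *)
Lemma alternating_path : (exists x y, e1 x y != e2 x y) ->
  exists a b c d, [/\ red a b, blue b c, red c d, a != d & ~~ red a d].
Proof.
move=> [x0 [y0 ne]]; apply: NNPP => no.
have stuck a b c d : red a b -> blue b c -> red c d -> a != d -> red a d.
  move=> ab bc cd ad; apply: contraT => nad; case: no.
  by exists a, b, c, d.
have [v _ vmax] := @arg_maxnP V x0 xpredT (fun x => #|R x|) isT.
have Rv : 0 < #|R v|.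
  apply: leq_trans (vmax x0 isT).
  have : (y0 \in R x0) || (y0 \in B x0).
    by rewrite !inE /red /blue; case: (e1 _ _) (e2 _ _) ne => [] [].
  case/orP=> y0in; first by apply/card_gt0P; exists y0.
  by rewrite card_red_blue; apply/card_gt0P; exists y0.
have [c] : exists c, c \in B v by apply/card_gt0P; rewrite -card_red_blue.
rewrite inE => vc.
have [d] : exists d, d \in R c.
  apply/card_gt0P; rewrite card_red_blue; apply/card_gt0P.
  by exists v; rewrite inE blue_sym.
rewrite inE => cd.
have cR : c \notin R v by rewrite inE /red; case/andP: vc => ->; rewrite andbF.
have sub : R v :\ d \subset R d.
  apply/subsetP => a; rewrite !inE => /andP[ad va].
  by rewrite red_sym; apply: stuck vc cd ad; rewrite red_sym.
have cv : c != v by apply: contraTneq vc => ->; rewrite /blue i2.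
have vR : v \notin R v by rewrite inE /red i1.
have : #|R d| <= #|R v| := vmax d isT.
rewrite leqNgt => /negP; apply.
have [dv|dv] := boolP (d \in R v); last first.
  apply: (@leq_trans #|c |: R v|); first by rewrite cardsU1 cR.
  apply: subset_leq_card; rewrite subUset sub1set inE red_sym cd.
  by apply: subset_trans sub; rewrite subsetD1 subxx.
apply: (@leq_trans #|c |: (v |: (R v :\ d))|).
  rewrite !cardsU1 (cardsD1 d (R v)) dv !inE (negbTE cv) /=.
  by rewrite !inE in cR vR; rewrite (negbTE cR) (negbTE vR) !andbF.
apply: subset_leq_card; rewrite !subUset !sub1set !inE red_sym cd.
by rewrite red_sym; rewrite inE in dv; rewrite dv.
Qed.

End SymmetricDifference.

Definition discrepancy (V : finType) (e1 e2 : rel V) :=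
  #|[set p : V * V | e1 p.1 p.2 != e2 p.1 p.2]|.

(** Three of the four toggled pairs become correct and only [ad] may become wrong. Ordered pairs are
    counted: [T] holds one orientation of each of the three, which already outweighs the two
    orientations of [ad]. *)
Lemma discrepancy_switch (V : finType) (e1 e2 e3 : rel V) a b c d :
    uniq [:: a; b; c; d] -> symmetric e1 -> symmetric e2 ->
    (forall x y, e3 x y = e1 x y (+) on_cycle a b c d x y) ->
    e1 a b != e2 a b -> e1 b c != e2 b c -> e1 c d != e2 c d ->
  discrepancy e3 e2 < discrepancy e1 e2.
Proof.
rewrite /= !inE !negb_or => /and4P[/and3P[ab ac ad] /andP[bc bd] cd _].
move=> s1 s2 e3E Eab Ebc Ecd; rewrite /discrepancy.
set D1 := [set p | e1 _ _ != _]; set D3 := [set p | _].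
pose T := [set (a, b); (b, c); (c, d)].
have cardT : #|T| = 3.
  by rewrite /T -setUA !cardsU1 cards1 !inE !xpair_eqE (negbTE ab) (negbTE bc)
      (negbTE ac).
have neq_negb (p q : bool) : p != q -> p = ~~ q by case: p q => [] [].
have TD : T \subset D1 by apply/subsetP => p; rewrite !inE => /orP[/orP[]|] /eqP->.
have sub : D3 \subset [set (a, d); (d, a)] :|: (D1 :\: T).
  apply/subsetP => -[x y]; rewrite in_setU => Dxy.
  case: (boolP (_ \in [set _; _])) => //= nad; move: Dxy.
  rewrite !inE /= e3E; case: (boolP (on_cycle _ _ _ _ _ _)) => [on|off].
    have -> : e1 x y = ~~ e2 x y.
      move: on nad; rewrite /on_cycle /same_pair !inE !xpair_eqE.
      case/or4P=> /orP[] /andP[/eqP-> /eqP->]; rewrite ?eqxx ?orbT // => _;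
        rewrite 1?[e1 b a]s1 1?[e2 b a]s2 1?[e1 c b]s1 1?[e2 c b]s2;
        rewrite 1?[e1 d c]s1 1?[e2 d c]s2;
        exact: neq_negb.
    by rewrite addbT negbK eqxx.
  rewrite addbF => ->; rewrite andbT; apply: contraNN off.
  rewrite /on_cycle /same_pair !xpair_eqE.
  by case/orP=> [/orP[]|] /andP[-> ->]; rewrite ?orbT.
apply: leq_ltn_trans (subset_leq_card sub) _.
have := cardsUI [set (a, d); (d, a)] (D1 :\: T).
rewrite cards2 cardsD (setIidPr TD) cardT => eq_card.
have : 3 <= #|D1| by rewrite -cardT subset_leq_card.
have := leq_addr #|[set (a, d); (d, a)] :&: (D1 :\: T)| #|[set (a, d);
    (d, a)] :|: (D1 :\: T)|.
rewrite eq_card => le1 le3; apply: leq_ltn_trans le1 _.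
by case: #|D1| le3 => [|[|[|n]]] // _; rewrite -[n.+3]addn3 addnK addn3; case: (_ != _).
Qed.

Lemma discrepancyC (V : finType) (e1 e2 : rel V) :
  discrepancy e1 e2 = discrepancy e2 e1.
Proof. by apply: eq_card => p; rewrite !inE eq_sym. Qed.

Lemma free_iso F G H : iso G H -> free F G -> free F H.
Proof. by move=> /iso_sym/iso_emb/free_emb; apply. Qed.

(** Induction on the number of disagreements: an alternating path provides a switch in one of the
    two graphs that lowers it. *)
Lemma switch_connected F :
    (forall (G : sgraph) (a b c d : G), switchable a b c d ->
       free F G -> free F (switch a b c d)) ->
  forall (V : finType) (e1 e2 : rel V) s1 i1 s2 i2,
    (forall x, #|[set y | e1 x y]| = #|[set y | e2 x y]|) ->
  free F (@SGraph V e1 s1 i1) -> free F (@SGraph V e2 s2 i2).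
Proof.
move=> closed V e1 e2 s1 i1 s2 i2.
have [n] := ubnP (discrepancy e1 e2).
elim: n => // n IHn in e1 e2 s1 i1 s2 i2 *; rewrite ltnS => le_n deg12 fr1.
have [[x [y ne]]|eq12] := classic (exists x y, e1 x y != e2 x y); last first.
  apply: free_iso fr1; exists id => [|x y]; first by exists id.
  by apply/eqP/negP => ne; apply: eq12; exists x, y; rewrite eq_sym; apply/negP.
have [|a [b [c [d [ab bc cd ad nad]]]]] := @alternating_path V e1 e2 s1 i1 s2 i2 deg12.
  by exists x, y.
case/andP: ab => ab1 ab2; case/andP: bc => bc2 bc1; case/andP: cd => cd1 cd2.
have b_c : b != c by apply: contraTneq bc2 => ->; rewrite i2.
have a_b : a != b by apply: contraTneq ab1 => ->; rewrite i1.
have c_d : c != d by apply: contraTneq cd1 => ->; rewrite i1.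
have neq := (ab1, bc2, cd1, negbTE ab2, negbTE bc1, negbTE cd2).
(* As [ad] is not red, an [e1]-edge [ad] is also an [e2]-edge. Then the cycle is switched in [e2],
   and the inverse switch carries freeness back to [e2]; otherwise it is switched in [e1]. *)
have [ad1|ad1] := boolP (e1 a d).
  have ad2 : e2 a d by apply: contraNT nad => ad2; rewrite ad1 ad2.
  have sw : @switchable (SGraph s2 i2) b c d a.
    by rewrite /switchable /= bc2 s2 ad2 cd2 ab2 c_d.
  apply: free_iso (switchK sw) _; apply: closed; first exact: switchable_switch.
  apply: (IHn e1 _ s1 i1) fr1 => [|z].
    apply: leq_trans le_n; rewrite discrepancyC [X in _ < X]discrepancyC.
    apply: (@discrepancy_switch _ _ _ _ a b c d); rewrite ?neq //.
      by have := switchable_uniq (switchable_switch (switchable_switch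
          (switchable_switch sw))).
    by move=> u v; have := @switchE (SGraph s2 i2) b c d a u v sw; rewrite on_cycle_rot.
  by rewrite deg12; apply/esym/(@switch_degree (SGraph s2 i2) b c d a z sw).
have sw : @switchable (SGraph s1 i1) a b c d.
  by rewrite /switchable /= ab1 cd1 bc1 s1 ad1 b_c eq_sym.
have := closed _ _ _ _ _ sw fr1; apply: IHn => [|z]; last first.
  by rewrite -deg12; apply: (@switch_degree (SGraph s1 i1) a b c d z sw).
apply: leq_trans le_n; apply: (@discrepancy_switch _ _ _ _ a b c d).
- exact: switchable_uniq sw.
- exact: s1.
- exact: s2.
- by move=> u v; apply: (@switchE (SGraph s1 i1) a b c d u v sw).
- by rewrite !neq.
- by rewrite !neq.
- by rewrite !neq.
Qed.

Theorem DSF_switch F : DSF F <->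
  forall (G : sgraph) (a b c d : G), switchable a b c d ->
    free F G -> free F (switch a b c d).
Proof.
split=> [/DSF_degree dsfF G a b c d sw|closed].
  apply: dsfF; apply: (@bij_degree_seq G (switch a b c d) id) => [|x].
    by exists id.
  exact: switch_degree.
apply/DSF_degree => G H /degree_seq_bij [f f_bij fE] frG.
pose e : rel G := fun x y => sedge (f x) (f y).
have s : symmetric e by move=> x y; apply: sedge_sym.
have i : irreflexive e by move=> x; apply: sedge_irr.
have GH : iso (SGraph s i) H by exists f.
apply: free_iso GH _; case: G => V e1 s1 i1 in f f_bij fE frG e s i *.
apply: (switch_connected closed _ frG) => x.
have := fE x; rewrite /degree /= => <-.
rewrite -(on_card_preimset (onW_bij _ f_bij)).
by apply: eq_card => y; rewrite !inE.
Qed.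

(** * Computing with small graphs *)

(* [andb], [orb], [has] and [all] are strict under [vm_compute]; the searches
   below need the short-circuiting versions. *)
Notation "b1 &&& b2" := (if b1 then b2 else false)
  (at level 40, left associativity).
Notation "b1 ||| b2" := (if b1 then true else b2)
  (at level 50, left associativity).

Fixpoint any T (p : pred T) s := if s is x :: s' then p x ||| any p s' else false.
Fixpoint every T (p : pred T) s :=
  if s is x :: s' then p x &&& every p s' else true.

Lemma anyE T (p : pred T) s : any p s = has p s.
Proof. by elim: s => //= x s ->. Qed.

Lemma everyE T (p : pred T) s : every p s = all p s.
Proof. by elim: s => //= x s ->. Qed.

Lemma ltbE m n : Nat.ltb m n = (m < n).
Proof. by rewrite /Nat.ltb; elim: m n => [|m IHm] [|n] //=; apply: IHm. Qed.

Fixpoint sublists T (s : seq T) : seq (seq T) :=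
  if s is x :: s' then let l := sublists s' in l ++ map (cons x) l
  else [:: [::]].

Lemma filter_sublists (T : eqType) (p : pred T) s : filter p s \in sublists s.
Proof.
elim: s => //= x s IHs; rewrite mem_cat; case: (p x); last by rewrite IHs.
by rewrite map_f ?orbT.
Qed.

(* Row [i] of a code lists the neighbours [j < i] of the vertex [i]. *)
Definition code := seq (seq nat).

Definition adj (c : code) : rel nat := fun i j =>
  if Nat.ltb j i then any (eqn j) (nth [::] c i)
  else Nat.ltb i j &&& any (eqn i) (nth [::] c j).

Lemma adjE c i j : adj c i j =
  (j < i) && (j \in nth [::] c i) || (i < j) && (i \in nth [::] c j).
Proof.
rewrite /adj !ltbE !anyE; have memE k s : has (eqn k) s = (k \in s).
  by rewrite -has_pred1; apply: eq_has => l; rewrite /= eq_sym.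
by rewrite !memE; case: ltngtP => //=; rewrite orbF.
Qed.

Lemma adj_sym c : symmetric (adj c).
Proof. by move=> i j; rewrite !adjE orbC. Qed.

Lemma adj_irr c : irreflexive (adj c).
Proof. by move=> i; rewrite adjE ltnn. Qed.

Definition cgraph (c : code) : sgraph :=
  @SGraph 'I_(size c) (fun i j => adj c i j)
    (fun i j => adj_sym c i j) (fun i => adj_irr c i).

Definition code_of (r : rel nat) n : code :=
  [seq [seq j <- iota 0 i | r j i] | i <- iota 0 n].

Lemma size_code_of r n : size (code_of r n) = n.
Proof. by rewrite size_map size_iota. Qed.

Lemma adj_code_of r n i j : {in gtn n &, symmetric r} -> i < n -> j < n ->
  adj (code_of r n) i j = (i != j) && r i j.
Proof.
move=> rsym lt_i lt_j; rewrite adjE /code_of.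
rewrite !(nth_map 0) ?size_iota // !nth_iota // !mem_filter !mem_iota /= !add0n.
by case: ltngtP => //=; rewrite ?andbT ?andbF ?orbF // rsym.
Qed.

(** [h] need not reach all of [G]: [r] describes an induced subgraph, so [embeds] can exhibit
    members in a graph that is only partly known. *)
Definition models (G : sgraph) n (r : rel nat) (h : nat -> G) :=
  {in gtn n &, injective h} /\
  {in gtn n &, forall i j, sedge (h i) (h j) = r i j}.

Section Embeddings.
Variables (a : code) (n : nat) (r : rel nat).

(* The images of the vertices of [a] are listed with the latest one first. *)
Fixpoint fits k s x :=
  if s is y :: s' then
    ~~ eqn x y &&& eqb (r x y) (adj a k (size s')) &&& fits k s' x
  else true.

Fixpoint extends todo s :=
  if todo is t.+1 then
    any (fun x => fits (size s) s x &&& extends t (x :: s)) (iota 0 n)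
  else true.

Definition embeds := extends (size a) [::].

Lemma fitsP k s x : fits k s x = (x \notin s) &&
  all (fun i => r x (nth 0 (rev s) i) == adj a k i) (iota 0 (size s)).
Proof.
elim: s => // y s IHs;
    have -> : iota 0 (size (y :: s)) = rcons (iota 0 (size s)) (size s).
  by rewrite -cats1 -(iotaD 0 _ 1) addn1.
rewrite /= IHs inE negb_or -[eqn x y]/(x == y).
rewrite all_rcons rev_cons nth_rcons size_rev ltnn eqxx.
have -> : all (fun i => r x (nth 0 (rcons (rev s) y) i) == adj a k i)
            (iota 0 (size s))
        = all (fun i => r x (nth 0 (rev s) i) == adj a k i) (iota 0 (size s)).
  by apply: eq_in_all => i; rewrite mem_iota add0n nth_rcons size_rev => /= ->.
case: (x == y) => //=; rewrite eqbE; case: (_ == _); rewrite ?andbT ?andbF //.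
Qed.

Fixpoint good s :=
  if s is x :: s' then [&& x < n, fits (size s') s' x & good s'] else true.

Lemma extends_good todo s : good s -> extends todo s ->
  exists2 s', size s' = size s + todo & good s'.
Proof.
elim: todo s => [|t IHt] s good_s /=; first by exists s; rewrite ?addn0.
rewrite anyE => /hasP[x]; rewrite mem_iota add0n => /= lt_x.
case fx: (fits _ _ _) => //= /IHt [|s' sz_s' good_s'].
  by rewrite /= lt_x fx.
by exists s'; rewrite // sz_s' addSnnS.
Qed.

Lemma goodP s : good s -> [/\ uniq s, all (gtn n) s &
  forall i j, j < i < size s -> r (nth 0 (rev s) i) (nth 0 (rev s) j) = adj a i j].
Proof.
elim: s => [_|x s IHs /= /and3P[lt_x]]; first by split=> // i j; rewrite andbF.
rewrite fitsP => /andP[xs /allP xE].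
case/IHs=> -> -> sE; rewrite xs lt_x; split=> // i j /andP[ji].
rewrite ltnS rev_cons !nth_rcons !size_rev leq_eqVlt => /orP[/eqP i_s|lt_is].
  by rewrite i_s ltnn eqxx -{1}i_s ji; apply/eqP/xE; rewrite mem_iota -i_s.
by rewrite lt_is (ltn_trans ji lt_is); apply: sE; rewrite ji.
Qed.

Lemma embeds_sound (G : sgraph) (h : nat -> G) : models n r h -> embeds -> emb
    (cgraph a) G.
Proof.
move=> [h_inj hE] /(@extends_good _ [::])-/(_ isT) [s sz /goodP[s_uniq lt_s sE]].
rewrite add0n in sz.
have lt_nth (i : 'I_(size a)) : nth 0 (rev s) i < n.
  by apply: (allP lt_s); rewrite -mem_rev mem_nth // size_rev sz.
exists (fun i : cgraph a => h (nth 0 (rev s) (i : 'I_(size a)))) => [i j eq_h|i j].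
  have /eqP := h_inj _ _ (lt_nth i) (lt_nth j) eq_h.
  by rewrite nth_uniq ?size_rev ?sz ?rev_uniq // => /eqP/val_inj.
have [lt_ij|lt_ji|/val_inj ->] := ltngtP (i : 'I__) (j : 'I__).
- by rewrite sedge_sym [RHS]sedge_sym hE; [apply: sE;
    rewrite lt_ij sz /= | apply: lt_nth..].
- by rewrite hE; [apply: sE; rewrite lt_ji sz /= | apply: lt_nth..].
- by rewrite !sedge_irr.
Qed.

Lemma embeds_complete (G : sgraph) (h : nat -> G) : models n r h ->
  (forall x, exists2 i, i < n & h i = x) -> emb (cgraph a) G -> embeds.
Proof.
move=> [h_inj hE] h_surj [f f_inj fE].
have ex i : exists k, (i < size a) ==> (k < n).
  case: (ltnP i (size a)) => [lt_i|_]; last by exists 0.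
  by have [k lt_k _] := h_surj (f (Ordinal lt_i)); exists k.
have ex_p (i : 'I_(size a)) : exists k, (k < n) && (h k == f i).
  by have [k lt_k eq_k] := h_surj (f i); exists k; rewrite lt_k eq_k /=.
pose p i := if insub i is Some i' then xchoose (ex_p i') else 0.
have pE i (lt_i : i < size a) : p i < n /\ h (p i) = f (Ordinal lt_i).
  by rewrite /p insubT; have /andP[-> /eqP] := xchooseP (ex_p (Ordinal lt_i)).
have p_inj i j : i < size a -> j < size a -> p i = p j -> i = j.
  move=> lt_i lt_j eq_p; have [_] := pE i lt_i; rewrite eq_p.
  by have [_ ->] := pE j lt_j => /f_inj [].
have rE i j : i < size a -> j < size a -> r (p i) (p j) = adj a i j.
  move=> lt_i lt_j; have [pi ei] := pE i lt_i; have [pj ej] := pE j lt_j.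
  by rewrite -hE // ei ej fE.
have ext todo k : k + todo = size a -> extends todo (rev (mkseq p k)).
  elim: todo k => // t IHt k def_k;
      have lt_k : k < size a by rewrite -def_k addnS ltnS leq_addr.
  rewrite /= anyE; apply/hasP; exists (p k).
    by rewrite mem_iota add0n; case: (pE k lt_k).
  rewrite fitsP size_rev size_mkseq revK mem_rev.
  have -> : p k \notin mkseq p k.
    apply/negP=> /mapP[i]; rewrite mem_iota add0n => /= lt_i /p_inj eq_ki.
    by have := lt_i; rewrite -eq_ki ?ltnn // (ltn_trans lt_i).
  have -> : all (fun i => r (p k) (nth 0 (mkseq p k) i) == adj a k i) (iota 0 k).
    apply/allP => i; rewrite mem_iota add0n => /= lt_i.
    by rewrite nth_mkseq // rE // (ltn_trans lt_i).
  by rewrite -rev_rcons -mkseqS; apply: IHt; rewrite addSnnS.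
exact: (ext _ 0).
Qed.

End Embeddings.

Definition cvertex c (x0 : cgraph c) (i : nat) : cgraph c := insubd x0 i.

Lemma cvertex_models c (x0 : cgraph c) : models (size c) (adj c) (cvertex x0).
Proof.
have valE i : i < size c -> val (cvertex x0 i) = i.
  by move=> lt_i; rewrite val_insubd lt_i.
split=> [i j lt_i lt_j /(congr1 val)|i j lt_i lt_j]; first by rewrite !valE.
by move: (valE i lt_i) (valE j lt_j) => /= -> ->.
Qed.

Lemma cvertex_surj c (x0 x : cgraph c) : exists2 i, i < size c & cvertex x0 i = x.
Proof. by exists (val x); [apply: ltn_ord | apply: valKd]. Qed.

Lemma embedsP a c :
  embeds a (size c) (adj c) <-> emb (cgraph a) (cgraph c).
Proof.
case: c => [|row c].
  case: a => [|row' a]; split=> //; last by case=> f; case: (f ord0).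
  by exists id.
set x0 : cgraph (row :: c) := ord0; split.
  exact/embeds_sound/(cvertex_models x0).
exact/(embeds_complete (cvertex_models x0))/(cvertex_surj x0).
Qed.

Definition cembeds a c := embeds a (size c) (adj c).
Definition ciso a c := eqn (size a) (size c) &&& cembeds a c.

Lemma cisoP a c : ciso a c <-> iso (cgraph a) (cgraph c).
Proof.
rewrite /ciso -[eqn _ _]/(_ == _); split.
  by case: eqP => // sz /embedsP/emb_iso; apply; rewrite !card_ord sz.
move=> isoac; have := iso_card isoac; rewrite !card_ord => ->.
by rewrite eqxx; apply/embedsP/iso_emb.
Qed.

Lemma code_of_iso (G : sgraph) n r (h : nat -> G) : models n r h ->
    (forall x, exists2 i, i < n & h i = x) ->
  iso (cgraph (code_of r n)) G.
Proof.
move=> [h_inj hE] h_surj; have szE := size_code_of r n.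
have lt_n (i : cgraph (code_of r n)) : (i : 'I__) < n by rewrite -[X in _ < X]szE.
have f_inj : injective (fun i : cgraph (code_of r n) => h (i : 'I__)).
  by move=> i j /(h_inj _ _ (lt_n i) (lt_n j))/val_inj.
exists (fun i : cgraph (code_of r n) => h (i : 'I__)) => [|i j].
  apply: inj_card_bij f_inj _; rewrite card_ord szE.
  have [p pP] : exists p : G -> 'I_n, forall x, h (p x) = x.
    have ex x : exists i : 'I_n, h i == x.
      by have [i lt_i <-] := h_surj x; exists (Ordinal lt_i) => /=.
    by exists (fun x => xchoose (ex x)) => x; apply/eqP/(xchooseP (ex x)).
  rewrite -[X in _ <= X](card_ord n);
      exact: leq_card (@can_inj _ _ p (fun i : 'I_n => h i) pP).
rewrite hE; try exact: lt_n.
have [/val_inj ->|ne] := eqVneq (i : nat) (j : nat).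
  by rewrite sedge_irr -(hE _ _ (lt_n j) (lt_n j)) sedge_irr.
rewrite /= adj_code_of ?ne //; try exact: lt_n.
by move=> k l lt_k lt_l; rewrite -!hE // sedge_sym.
Qed.

Fixpoint codes n : seq code :=
  if n is m.+1 then
    flatten [seq [seq rcons c row | row <- sublists (iota 0 m)] | c <- codes m]
  else [:: [::]].

Lemma code_of_codes r n : code_of r n \in codes n.
Proof.
elim: n => // n IHn /=; apply/flatten_mapP; exists (code_of r n) => //.
apply/mapP; exists [seq j <- iota 0 n | r j n]; first exact: filter_sublists.
by rewrite /code_of -[n.+1]addn1 iotaD map_cat cats1.
Qed.

Lemma iso_code (G : sgraph) : exists2 c, c \in codes #|G| & iso G (cgraph c).
Proof.
have [G0|] := posnP #|G|.
  exists [::]; first by rewrite G0.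
  apply: emb_iso; last by rewrite card_ord G0.
  have f (x : G) : cgraph [::] by have := card0_eq G0 x.
  by exists f => x; have := card0_eq G0 x.
case/card_gt0P=> x0 _; pose h i := nth x0 (enum G) i.
pose r : rel nat := fun i j => sedge (h i) (h j).
exists (code_of r #|G|); first exact: code_of_codes.
apply/iso_sym/(code_of_iso (h := h)) => [|x].
  split=> // i j; rewrite !inE cardE => lt_i lt_j /eqP.
  by rewrite nth_uniq ?enum_uniq // => /eqP.
by exists (index x (enum G)); rewrite /h ?cardE ?index_mem ?nth_index ?mem_enum.
Qed.

Definition csub (c : code) (s : seq nat) : code :=
  code_of (fun i j => adj c (nth 0 s i) (nth 0 s j)) (size s).

Lemma emb_csub W c : emb W (cgraph c) ->
  exists2 s, s \in sublists (iota 0 (size c)) & iso W (cgraph (csub c s)).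
Proof.
case=> f f_inj fE.
pose s := [seq i <- iota 0 (size c) | has (fun x => val (f x) == i) (enum W)].
have fs x : val (f x) \in s.
  rewrite mem_filter mem_iota ltn_ord !andbT; apply/hasP.
  by exists x; rewrite ?mem_enum.
have s_uniq : uniq s by rewrite filter_uniq ?iota_uniq.
exists s; first exact: filter_sublists.
apply: emb_iso; last first.
  rewrite card_ord size_code_of cardE -(size_map (fun x => val (f x))).
  apply: uniq_leq_size => // i; rewrite mem_filter => /andP[/hasP[x xW /eqP <-] _].
  exact: (map_f (fun x => val (f x))).
have lt_g x : index (val (f x)) s < size (csub c s) by rewrite size_code_of index_mem.
exists (fun x => Ordinal (lt_g x) : cgraph (csub c s)) => [x y|x y].
  by case=> /(congr1 (nth 0 s)); rewrite !(nth_index _ (fs _)) => /val_inj/f_inj.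
rewrite /= adj_code_of ?inE ?index_mem ?fs //; last by move=> i j _ _; apply: adj_sym.
rewrite !(nth_index _ (fs _)) -fE /=; have [eq_i|//] := eqVneq (index _ s).
have := nth_index 0 (fs x); rewrite eq_i (nth_index _ (fs y)) => /val_inj->.
by rewrite [RHS]adj_irr.
Qed.

Definition ccompl (c : code) : code := code_of (fun i j => ~~ adj c i j) (size c).

Lemma ccompl_iso c : iso (cgraph (ccompl c)) (complement (cgraph c)).
Proof.
have sz : size (ccompl c) = size c by rewrite size_code_of.
apply: emb_iso; last by rewrite !card_ord sz.
exists (fun i : cgraph (ccompl c) => cast_ord sz i : complement (cgraph c)).
  exact: cast_ord_inj.
move=> i j; rewrite /= /compl_edge /= adj_code_of -?sz ?ltn_ord //.
by move=> {}i {}j _ _; rewrite adj_sym.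
Qed.

Lemma cset_iso (L : seq code) G H : iso G H ->
  (exists2 c, c \in L & iso G (cgraph c)) ->
  exists2 c, c \in L & iso H (cgraph c).
Proof.
by move=> /iso_sym HG [c cL Gc]; exists c => //; apply: iso_trans Gc.
Qed.

Definition cset (L : seq code) : graph_set := GraphSet (@cset_iso L).

Definition cfree L n r := ~~ any (fun a => embeds a n r) L.

Lemma free_cset L G : free (cset L) G <-> forall c, c \in L -> ~ emb (cgraph c) G.
Proof.
split=> [/freeE fr c cL|fr]; first by apply: fr; exists c => //; apply: iso_refl.
apply/freeE => H [c cL Hc] HG; apply: (fr c cL).
by apply: emb_trans HG; apply/iso_emb/iso_sym.
Qed.

(** ** Deciding whether a finite set is degree-sequence-forcing *)

Definition npair p q i j := eqn i p &&& eqn j q ||| (eqn i q &&& eqn j p).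

Definition nswitch (r : rel nat) a b c d : rel nat := fun i j =>
  if npair a b i j ||| npair b c i j ||| npair c d i j ||| npair d a i j
  then ~~ r i j else r i j.

Lemma nswitchE r a b c d i j :
  nswitch r a b c d i j = r i j (+) on_cycle a b c d i j.
Proof.
have pairE p q : npair p q i j = same_pair p q i j by [].
rewrite /nswitch !pairE /on_cycle.
case: (same_pair a b i j); case: (same_pair b c i j) => /=;
  rewrite ?addbT ?addbF //.
by case: (same_pair c d i j); case: (same_pair d a i j); rewrite ?addbT ?addbF.
Qed.

(* [g] is the part already known of the outcome of a switch on [a, b, c, d];
   the neighbourhoods of [k] further vertices are enumerated until undoing the
   switch exhibits a member of [L]. *)
Section Check.
Variables (L : seq code) (a b c d : nat).

Definition known n (r : rel nat) e x y :=
  if Nat.ltb x n &&& Nat.ltb y n then eqb (r x y) e else true.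

(** In the outcome [a b] and [c d] are non-edges while [b c] and [d a] are edges; a [g] that
    contradicts this describes no outcome and passes. *)
Fixpoint check_switch k (g : code) :=
  let n := size g in let r := adj g in
  if known n r false a b &&& known n r true b c &&&
     known n r false c d &&& known n r true d a
  then any (fun h => embeds h n (nswitch r a b c d)) L |||
       (if k is k'.+1 then
          every (fun row => check_switch k' (rcons g row)) (sublists (iota 0 n))
        else false)
  else true.

End Check.

Section CheckSound.
Variables (L : seq code) (G : sgraph) (a b c d : G).
Hypotheses (sw : switchable a b c d)
           (freeL : forall h, h \in L -> ~ emb (cgraph h) G).
Variables (x0 : G) (T : seq G).
Hypotheses (T_uniq : uniq T) (aT : a \in T) (bT : b \in T) (cT : c \in T)
           (dT : d \in T).
Let G' := switch a b c d.
Let h : nat -> G' := nth x0 T.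
Let pos x := index x T.

(** A successful check contradicts [freeL]: along the branch that records the actual neighbourhoods
    in the outcome, undoing the switch exhibits a member of [L] inside [G]. *)
Lemma check_switch_sound k (g : code) :
    size g + k = size T -> models (size g) (adj g) h ->
  check_switch L (pos a) (pos b) (pos c) (pos d) k g -> False.
Proof.
have hpos x : x \in T -> h (pos x) = x by apply: nth_index.
have pos_eq i x : i < size T -> x \in T -> (i == pos x) = (h i == x).
  move=> lt_i xT; rewrite -{2}(hpos x xT).
  by rewrite (nth_uniq x0 lt_i _ T_uniq) ?index_mem.
have knownE n r x y e : x \in T -> y \in T -> @sedge G' x y = e ->
    {in gtn n &, forall i j, sedge (h i) (h j) = r i j} ->
    known n r e (pos x) (pos y).
  move=> xT yT xy rE; rewrite /known !ltbE.
  case: ltnP => //= lt_x; case: ltnP => //= lt_y.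
  by rewrite -rE // !hpos // xy eqbE.
have [bc da ncd nab _] := and5P (switchable_switch sw).
have no_member n r : n <= size T -> models n r h ->
    has (fun f => embeds f n (nswitch r (pos a) (pos b) (pos c) (pos d))) L = false.
  move=> le_n [h_inj hE]; apply/hasP => -[f fL f_emb].
  apply: (freeL fL); apply: (embeds_sound (h := h : nat -> G)) f_emb.
  split=> // i j lt_i lt_j; rewrite nswitchE -hE // switchE //.
  have [le_i le_j] := (leq_trans lt_i le_n, leq_trans lt_j le_n).
  rewrite /on_cycle /same_pair !pos_eq //; exact: esym (addbK _ _).
elim: k g => [|k IHk] g szT gm /=; set n := size g in szT gm *;
  have [h_inj hE] := gm; have le_n : n <= size T by rewrite -szT leq_addr.
- rewrite !(knownE _ _ _ _ _ _ _ _ hE) //=; try exact: negbTE.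
  by rewrite anyE no_member.
rewrite !(knownE _ _ _ _ _ _ _ _ hE) //=; try exact: negbTE.
rewrite anyE no_member // everyE => /allP chk.
have lt_n : n < size T by rewrite -szT addnS ltnS leq_addr.
pose row := [seq i <- iota 0 n | sedge (h n) (h i)].
have rowE i : i < n -> (i \in row) = sedge (h n) (h i).
  by move=> lt_i; rewrite mem_filter mem_iota add0n lt_i !andbT.
apply: (IHk (rcons g row)); [|split|exact/chk/filter_sublists].
- by rewrite size_rcons addSnnS.
- move=> i j; rewrite !inE size_rcons => lt_i lt_j /eqP.
  by rewrite nth_uniq ?(leq_trans lt_i) ?(leq_trans lt_j) // => /eqP.
have adj_old i j : i < n -> j < n -> adj (rcons g row) i j = adj g i j.
  by move=> lt_i lt_j; rewrite !adjE !nth_rcons lt_i lt_j.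
have adj_new i : i < n -> adj (rcons g row) n i = sedge (h n) (h i).
  move=> lt_i; rewrite adjE lt_i nth_rcons ltnn eqxx rowE //.
  by rewrite ltnNge (ltnW lt_i) /= orbF.
move=> i j; rewrite !inE size_rcons !ltnS [i <= _]leq_eqVlt [j <= _]leq_eqVlt.
case/orP=> [/eqP->|lt_i] /orP[/eqP->|lt_j].
- by rewrite sedge_irr adj_irr.
- by rewrite adj_new.
- by rewrite sedge_sym adj_sym adj_new.
- by rewrite adj_old // hE.
Qed.

End CheckSound.

(** Switch vertices outside the copy of [h] are numbered from [m] on in their order of occurrence in
    [a, b, c, d]; other numberings are equivalent. A switch with at most one vertex in the copy
    passes at once, since it leaves the copy intact. *)
Definition check_at L h a b c d :=
  let m := size h in let s := [seq x <- [:: a; b; c; d] | m <= x] in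
  if uniq [:: a; b; c; d] && (s == iota m (size s))
  then check_switch L a b c d (size s) h else true.

Definition check_DSF (L : seq code) := every (fun h =>
  let l := iota 0 (size h + 4) in
  every (fun a => every (fun b => every (fun c => every (check_at L h a b c) l)
  l) l) l) L.

Lemma index_iota (T : eqType) (s : seq T) :
  uniq s -> map (index^~ s) s = iota 0 (size s).
Proof.
move=> s_uniq; case: s s_uniq => // x s s_uniq.
apply: (@eq_from_nth _ 0) => [|i]; rewrite size_map ?size_iota // => lt_i.
by rewrite (nth_map x) // index_uniq // nth_iota.
Qed.

Lemma check_DSF_sound L : check_DSF L -> DSF (cset L).
Proof.
rewrite /check_DSF everyE => /allP chk; apply/DSF_switch => G a b c d sw.
move=> /free_cset frL; apply/free_cset => g gL [f f_inj fE].
pose s : seq G := map f (enum 'I_(size g)).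
have szs : size s = size g by rewrite size_map size_enum_ord.
pose t := [seq x <- [:: a; b; c; d] | x \notin s].
(* The copy of [g] in its own order, then the switch vertices outside it: the numbering expected by
   [check_at]. *)
pose T := s ++ t; pose pos x := index x T.
have t_uniq : uniq t by rewrite filter_uniq // (switchable_uniq sw).
have T_uniq : uniq T.
  rewrite cat_uniq t_uniq map_inj_uniq ?enum_uniq // andbT; apply/hasPn => x.
  by rewrite mem_filter => /andP[].
have inT x : x \in [:: a; b; c; d] -> x \in T.
  by move=> x_in; rewrite mem_cat mem_filter x_in andbT orbN.
have posE x : (size g <= pos x) = (x \notin s).
  rewrite /pos index_cat -szs; case: ifP => xs; last by rewrite leq_addr.
  by rewrite leqNgt index_mem xs.
have newE : [seq x <- [:: pos a; pos b; pos c; pos d] | size g <= x]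
          = iota (size g) (size t).
  rewrite -[[:: pos a; _; _; _]]/(map pos [:: a; b; c; d]) filter_map.
  rewrite (eq_filter (a2 := fun x => x \notin s)) => [|x]; last exact: posE.
  rewrite -/t -(addn0 (size g)) iotaDl -(index_iota t_uniq) -map_comp.
  apply/eq_in_map => x; rewrite mem_filter => /andP[xs _] /=.
  by rewrite /pos index_cat (negbTE xs) szs.
have in_l x : x \in [:: a; b; c; d] -> pos x \in iota 0 (size g + 4).
  move=> /inT; rewrite -index_mem mem_iota size_cat szs => lt_x /=.
  apply: leq_trans lt_x _; rewrite leq_add2l.
  by rewrite (leq_trans (size_subseq (filter_subseq _ _))).
have posU : uniq [:: pos a; pos b; pos c; pos d].
  rewrite -[[:: pos a; _; _; _]]/(map pos [:: a; b; c;
      d]) map_inj_in_uniq ?(switchable_uniq sw) //.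
  by move=> x y /inT xT /inT yT eq_p;
      rewrite -(nth_index a xT) -(nth_index a yT) -/(pos x) eq_p.
have [ina inb inc ind] : [/\ a \in [:: a; b; c; d], b \in [:: a; b; c; d],
    c \in [:: a; b; c; d] & d \in [:: a; b; c; d]].
  by rewrite !inE !eqxx !orbT.
have := chk g gL; rewrite everyE => /allP/(_ _ (in_l _ ina)).
rewrite everyE => /allP/(_ _ (in_l _ inb)).
rewrite everyE => /allP/(_ _ (in_l _ inc)).
rewrite everyE => /allP/(_ _ (in_l _ ind)).
rewrite /check_at newE posU size_iota eqxx andTb.
apply: (@check_switch_sound L G a b c d sw frL a T T_uniq);
  try by apply: inT; rewrite !inE eqxx ?orbT.
  by rewrite size_cat szs.
have hE (i : 'I_(size g)) : nth a T i = f i.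
  rewrite nth_cat szs ltn_ord (nth_map i) ?size_enum_ord ?ltn_ord //.
  by rewrite nth_ord_enum.
have gT : size g <= size T by rewrite size_cat szs leq_addr.
split=> [i j lt_i lt_j /eqP|i j lt_i lt_j].
  by rewrite nth_uniq ?(leq_trans lt_i) ?(leq_trans lt_j) // => /eqP.
by rewrite (hE (Ordinal lt_i)) (hE (Ordinal lt_j)) fE.
Qed.

(** * Four families met by every degree-sequence-forcing set *)

(** Walks of length three must backtrack. This forbids triangles and paths on four vertices as
    subgraphs, induced or not, so every component is a star. *)
Definition star_forest (G : sgraph) :=
  forall x y z w : G, sedge x y -> sedge y z -> sedge z w -> x = z \/ y = w.

Definition biclique (G : sgraph) :=
  exists f : G -> bool, forall x y, sedge x y = (f x != f y).

Lemma star_forest_emb A B : emb A B -> star_forest B -> star_forest A.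
Proof.
case=> f f_inj fE sB x y z w xy yz zw.
by case: (sB (f x) (f y) (f z) (f w)); rewrite ?fE // => /f_inj; [left|right].
Qed.

Lemma biclique_emb A B : emb A B -> biclique B -> biclique A.
Proof.
by case=> f f_inj fE [g gE]; exists (g \o f) => x y; rewrite -fE gE.
Qed.

(* On H together with its ordered pairs, join each edge's two darts (v,w), (w,v)
   to each other, or else erase H and hang the dart (v,w) on v: the degrees are
   the same, and the second graph is a forest of stars. *)
Lemma DSF_star_forest F H : DSF F -> F H -> exists2 W, F W & star_forest W.
Proof.
move=> dsfF FH; pose V : finType := (H + H * H)%type.
pose e1 : rel V := fun s t => match s, t with
  | inl x, inl y => sedge x y
  | inr p, inr q => (p == (q.2, q.1)) && sedge p.1 p.2
  | _, _ => false end.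
pose e2 : rel V := fun s t => match s, t with
  | inl x, inr p | inr p, inl x => (p.1 == x) && sedge p.1 p.2
  | _, _ => false end.
have s1 : symmetric e1.
  case=> [x|[x y]] [z|[z w]] //=; first exact: sedge_sym.
  rewrite !xpair_eqE [z == y]eq_sym [w == x]eq_sym.
  have [->|] := eqVneq x w; have [->|] := eqVneq y z; rewrite ?andbF //=.
  exact: sedge_sym.
have i1 : irreflexive e1.
  case=> [x|[x y]] /=; first exact: sedge_irr.
  by rewrite xpair_eqE; case: eqVneq => //= ->; rewrite sedge_irr ?andbF.
have s2 : symmetric e2 by case=> [x|[x y]] [z|[z w]].
have i2 : irreflexive e2 by case.
have [||W FW /star_forest_emb sW] := @DSF_find F V e1 e2 s1 i1 s2 i2 H dsfF FH.
- by exists inl => // x y [].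
- case=> [x|[x y]].
    transitivity #|[set y | sedge x y]|.
      have inj : injective (fun y => inl y : V) by move=> y z [].
      rewrite -(card_imset _ inj); apply: eq_card => -[y|p]; rewrite !inE /=.
        by rewrite mem_imset ?inE.
      by apply/esym/imsetP => -[].
    have inj : injective (fun y => inr (x, y) : V) by move=> y z [].
    rewrite -(card_imset _ inj); apply: eq_card => -[y|[z y]]; rewrite !inE /=.
      by apply/imsetP => -[].
    apply/imsetP/andP=> [[u] /[!inE] xu [-> ->]|[/eqP-> xy]] //.
    by exists y; rewrite ?inE.
  transitivity (nat_of_bool (sedge x y)).
    case xy: (sedge x y).
      apply/eqP/cards1P; exists (inr (y, x)); apply/setP => -[z|[z w]].
        by rewrite !inE.
      rewrite !inE /= xy andbT -[RHS]/((z, w) == (y, x)) !xpair_eqE.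
      by rewrite andbC [y == z]eq_sym [x == w]eq_sym.
    by apply/eqP; rewrite cards_eq0; apply/eqP/setP => -[z|[z w]];
      rewrite !inE //= xy andbF.
  case xy: (sedge x y).
    apply/esym/eqP/cards1P; exists (inl x); apply/setP => -[z|[z w]].
      by rewrite !inE /= xy andbT eq_sym.
    by rewrite !inE.
  by apply/esym/eqP; rewrite cards_eq0; apply/eqP/setP => -[z|[z w]];
    rewrite !inE //= xy andbF.
exists W => //; apply: sW => -[x|[x y]] [z|[z w]] [u|[u v]] [t|[t k]] //=.
  by move=> /andP[/eqP-> _] /andP[/eqP-> _]; left.
by move=> _ /andP[/eqP-> _] /andP[/eqP-> _]; right.
Qed.

(* H and its complement with loops, placed between two copies of H, make up a
   regular graph of degree n on 2n vertices, where n = #|H|; so is K_{n,n}. *)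
Lemma DSF_biclique F H : DSF F -> F H -> exists2 W, F W & biclique W.
Proof.
move=> dsfF FH; pose V : finType := (H * bool)%type.
pose e1 : rel V := fun s t => (s.2 != t.2) (+) sedge s.1 t.1.
pose e2 : rel V := fun s t => s.2 != t.2.
have s1 : symmetric e1 by move=> s t; rewrite /e1 eq_sym sedge_sym.
have i1 : irreflexive e1 by move=> s; rewrite /e1 eqxx sedge_irr.
have s2 : symmetric e2 by move=> s t; rewrite /e2 eq_sym.
have i2 : irreflexive e2 by move=> s; rewrite /e2 eqxx.
have [||W FW /biclique_emb bW] := @DSF_find F V e1 e2 s1 i1 s2 i2 H dsfF FH.
- by exists (fun x => (x, false)) => [x y []|x y].
- case=> x b; transitivity #|H|.
    (* Each [z] contributes exactly one neighbour of [(x, b)]: its copy in the same layer if [xz] is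
       an edge, in the other layer if not. *)
    have inj : injective (fun z => (z, ~~ b (+) sedge x z)) by move=> y z [].
    rewrite -cardsT -(card_imset _ inj); apply: eq_card => -[z c].
    apply/idP/imsetP => [|[y _ [-> ->]]]; rewrite !inE /e1 /=.
      move=> bc; exists z => //; congr (_, _); move: bc.
      by clear; case: b c (sedge x z) => [] [] [].
    by clear; case: b (sedge x y) => [] [].
  have inj : injective (fun z : H => (z, ~~ b)) by move=> y z [].
  rewrite -cardsT -(card_imset _ inj); apply: eq_card => -[z c].
  apply/imsetP/idP => [[y _ [-> ->]]|]; rewrite !inE /e2 /=; first by clear; case: b.
  by move=> bc; exists z => //; congr (_, _); move: bc; clear; case: b c => [] [].
by exists W => //; apply: bW; exists (fun s => s.2).
Qed.

Lemma switch_degree_sequence (G : sgraph) (a b c d : G) : switchable a b c d ->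
  degree_sequence (switch a b c d) = degree_sequence G.
Proof.
move=> sw; apply: (@bij_degree_seq (switch a b c d) G id) => [|x].
  by exists id.
by apply/esym/switch_degree.
Qed.

Lemma DSF_switch_find F (G : sgraph) (a b c d : G) X :
    DSF F -> switchable a b c d -> F X -> emb X (switch a b c d) ->
  exists2 W, F W & emb W G.
Proof.
move=> /DSF_degree dsfF sw FX XG; apply: not_free => frG.
have /freeE/(_ X FX) := dsfF _ _ (esym (switch_degree_sequence sw)) frG.
exact.
Qed.

Lemma DSF_find_switch F (G : sgraph) (a b c d : G) X :
    DSF F -> switchable a b c d -> F X -> emb X G ->
  exists2 W, F W & emb W (switch a b c d).
Proof.
move=> /DSF_degree dsfF sw FX XG; apply: not_free => frS.
have /freeE/(_ X FX) := dsfF _ _ (switch_degree_sequence sw) frS.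
exact.
Qed.

(** ** Cliques with one edge moved *)

(* Labels of the vertices of a clique plus possibly an isolated vertex: the
   edge [uv] of the clique has been replaced by two pendant edges [ux], [vy].
   The labels of u, v, x, y and of the isolated vertex are 0, 1, 2, 3, 4; all
   other vertices are labelled 5. *)
Definition label_adj (l m : nat) : bool :=
  [|| (l == 5) && (m \in [:: 0; 1; 5]), (m == 5) && (l \in [:: 0; 1]),
      (l == 0) && (m == 2), (l == 2) && (m == 0),
      (l == 1) && (m == 3) | (l == 3) && (m == 1)].

Lemma label_adj_sym : symmetric label_adj.
Proof.
move=> l m; rewrite /label_adj !inE.
by case: (l == 5); case: (m == 5); rewrite /= ?orbT //;
   case: (l == 0); case: (l == 1); case: (l == 2); case: (l == 3);
   case: (m == 0); case: (m == 1); case: (m == 2); case: (m == 3).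
Qed.

(** This places [W] as an induced subgraph of a clique with one edge moved, of unspecified size: the
    labels below 5 occur at most once, while the core labelled 5 is unbounded. *)
Definition labelling (W : sgraph) (g : W -> nat) :=
  [/\ forall x, g x < 6,
      forall x y, g x = g y -> x = y \/ g x = 5 &
      forall x y, x != y -> sedge x y = label_adj (g x) (g y)].

Definition moved_edge (W : sgraph) := exists g : W -> nat, labelling g.

Lemma moved_edge_emb A B : emb A B -> moved_edge B -> moved_edge A.
Proof.
case=> f f_inj fE [g [g6 g_inj gE]]; exists (g \o f); split=> [x|x y|x y xy] //=.
  by case/g_inj=> [/f_inj|]; [left|right].
by rewrite -fE gE ?(inj_eq f_inj).
Qed.

(** Vertices 0 to 4 carry their own number as label, and 5 to 8 form a core of four, the size
    allowed by [compl_core]. *)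
Definition base : code :=
  [:: [::]; [::]; [:: 0]; [:: 1]; [::];
      [:: 0; 1]; [:: 0; 1; 5]; [:: 0; 1; 5; 6]; [:: 0; 1; 5; 6; 7]].

Lemma labelling_base (W : sgraph) (g : W -> nat) :
  labelling g -> #|[set x | g x == 5]| <= 4 -> emb W (cgraph base).
Proof.
case=> g6 g_inj gE; set A := [set x | _] => A4.
(* The core is spread over the positions from 5 on, so that truncating a position at 5 recovers the
   label. *)
pose p x := if g x == 5 then 5 + index x (enum A) else g x.
have p_lt x : p x < size base.
  rewrite /p; case: eqP => [gx|]; last by move: (g6 x);
      case: (g x) => [|[|[|[|[|[|]]]]]].
  rewrite (leq_trans (_ : _ < 5 + #|A|)) ?(leq_add2l 5 _ 4) // ltn_add2l.
  by rewrite cardE index_mem mem_enum inE gx.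
have p_min x : minn (p x) 5 = g x.
  rewrite /p; case: eqP => [->|]; first by rewrite (minn_idPr (leq_addr _ _)).
  by move: (g6 x); case: (g x) => [|[|[|[|[|[|]]]]]].
have p_inj x y : p x = p y -> x = y.
  move=> eq_p; have eq_g : g x = g y by rewrite -p_min eq_p p_min.
  have [//|gx] := g_inj _ _ eq_g; move: eq_p; rewrite /p -eq_g gx eqxx.
  move/addnI=> eq_i; rewrite -(@nth_index _ x x (enum A)) ?mem_enum ?inE ?gx // eq_i.
  by rewrite nth_index // mem_enum inE -eq_g gx.
have adj_base i j : i < 9 -> j < 9 -> i != j ->
    adj base i j = label_adj (minn i 5) (minn j 5).
  have /allP chk : all (fun i => all (fun j => (i != j) ==>
      (adj base i j == label_adj (minn i 5) (minn j 5))) (iota 0 9)) (iota 0 9).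
    by vm_compute.
  move=> lt_i lt_j ne; have := chk i; rewrite mem_iota lt_i => /(_ isT)/allP/(_ j).
  by rewrite mem_iota lt_j ne => /(_ isT)/eqP.
exists (fun x => Ordinal (p_lt x) : cgraph base) => [x y [] /p_inj //|x y].
have [->|ne] := eqVneq x y; first by rewrite !sedge_irr.
by rewrite /= adj_base ?p_min -?gE //; apply: contraNneq ne => /p_inj->.
Qed.

(** Star forests and bicliques contain no triangle, so a triangle in any core of three vertices
    bounds their cores. *)
Lemma core_triangle (W : sgraph) (g : W -> nat) : labelling g ->
    2 < #|[set x | g x == 5]| ->
  exists x y z : W, [/\ sedge x y, sedge y z, sedge z x, x != z & y != x].
Proof.
case=> _ _ gE /card_gt2P[x [y [z [[]]]]]; rewrite !inE.
move=> /eqP gx /eqP gy /eqP gz [xy yz zx].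
by exists x, y, z; rewrite !gE ?gx ?gy ?gz // [x == z]eq_sym [y == x]eq_sym.
Qed.

Lemma star_forest_core (W : sgraph) (g : W -> nat) : labelling g -> star_forest W ->
  #|[set x | g x == 5]| <= 4.
Proof.
move=> gW sW; apply: (@leq_trans 2) => //; rewrite leqNgt; apply/negP.
case/(core_triangle gW)=> x [y [z [xy yz zx x_z y_x]]].
by case: (sW _ _ _ _ xy yz zx) => [/eqP|/eqP]; apply/negP.
Qed.

Lemma biclique_core (W : sgraph) (g : W -> nat) : labelling g -> biclique W ->
  #|[set x | g x == 5]| <= 4.
Proof.
move=> gW [f fE]; apply: (@leq_trans 2) => //; rewrite leqNgt; apply/negP.
case/(core_triangle gW)=> x [y [z [+ + + _ _]]].
by rewrite !fE; case: (f x) (f y) (f z) => [] [] [].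
Qed.

(* A clique of [W] is independent in the complement of [W], so its vertices
   have distinct classes among ux, vy, {4}, {5} there. *)
Lemma compl_core (W : sgraph) (g : W -> nat) : labelling g -> moved_edge
    (complement W) ->
  #|[set x | g x == 5]| <= 4.
Proof.
move=> [_ _ gE] [h [h6 h_inj hE]].
pose cl i := nth 0 [:: 0; 1; 0; 1; 2; 3] i.
have cl_lt x : cl (h x) < 4.
  by move: (h6 x); rewrite /cl; case: (h x) => [|[|[|[|[|[|]]]]]].
rewrite -[X in _ <= X]card_ord.
rewrite -(card_in_imset (f := fun x => Ordinal (cl_lt x))) ?max_card //.
move=> x y; rewrite !inE => /eqP gx /eqP gy /(congr1 val) /= eq_cl.
apply/eqP; apply: contraT => ne.
have := hE x y ne; rewrite /= /compl_edge ne gE // gx gy /=.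
have : h x = h y -> h x = 5 by move=> /h_inj[/eqP|] //; rewrite (negbTE ne).
have /allP chk : all (fun i => all (fun j => (cl i == cl j) ==>
    ((i != j) || (i == 5)) ==> label_adj i j) (iota 0 6)) (iota 0 6).
  by vm_compute.
have := chk (h x); rewrite mem_iota h6 => /(_ isT)/allP/(_ (h y)).
rewrite mem_iota h6 eq_cl eqxx => /(_ isT) /= chk_xy eq5.
by move: chk_xy; case: eqVneq => [/eq5->|_] /= ->.
Qed.

(** A biclique as complement makes [X] a union of at most two disjoint cliques. If both had two
    vertices, the complement would contain a 4-cycle, which is not in a star forest. [q] marks the
    clique that may be large. *)
Lemma clique_plus_vertex X :
    star_forest (complement X) -> biclique (complement X) ->
  exists q : X -> bool, (forall x y, ~~ q x -> ~~ q y -> x = y) /\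
    (forall x y, x != y -> sedge x y = q x && q y).
Proof.
move=> sX [f fE]; have fE' (x y : X) : x != y -> sedge x y = (f x == f y).
  move=> ne; have := fE x y; rewrite /= /compl_edge ne.
  by move=> /= /negb_inj.
have [t t1] : exists t, forall x y, f x = t -> f y = t -> x = y.
  apply: NNPP => no.
  have ex t : exists x y, [/\ f x = t, f y = t & x != y].
    apply: NNPP => no'; apply: no; exists t => x y fx fy; apply/eqP.
    by apply: contraT => ne; case: no'; exists x, y.
  have [x [y [fx fy /eqP ne]]] := ex true.
  have [z [w [fz fw /eqP ne']]] := ex false.
  by case: (sX x z y w) => //; rewrite fE ?fx ?fy ?fz ?fw.
exists (fun x => f x != t); split=> x y;
    first by rewrite !negbK => /eqP fx /eqP /(t1 _ _ fx).
move=> ne; rewrite fE' //; have := t1 x y; move: (f x) (f y) => fx fy.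
by case: t fx fy t1 => [] [] [] _ //= eq_xy; rewrite eq_xy ?eqxx in ne.
Qed.

(** The edge [uv] of the clique is switched with a disjoint [K 2], whose ends become pendant at [u]
    and [v]. As [X] is no star forest, its clique has at least three vertices. Each of them has two
    neighbours, so a copy of [X] in the outcome would map the clique onto itself, although [uv] is
    now missing. *)
Lemma DSF_moved_edge F X : DSF F -> F X ->
    star_forest (complement X) -> biclique (complement X) -> ~ star_forest X ->
  exists W, [/\ F W, moved_edge W & ~ emb X W].
Proof.
move=> dsfF FX sX bX nsX; have [q [q1 qE]] := clique_plus_vertex sX bX.
have : 2 < #|[set x | q x]|.
  rewrite ltnNge; apply/negP => le2; apply: nsX => x y z w xy yz zw; left.
  apply/eqP; apply: contraLR le2 => xz; rewrite -ltnNge; apply/card_gt2P.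
  have x_y : x != y by apply: contraTneq xy => ->; rewrite sedge_irr.
  have y_z : y != z by apply: contraTneq yz => ->; rewrite sedge_irr.
  exists x, y, z; split; last by rewrite [z == x]eq_sym.
  by move: xy yz; rewrite !qE // !inE => /andP[-> ->] /andP[_ ->].
case/card_gt2P=> u [v [w [[+ + +] [uv vw wu]]]]; rewrite !inE => qu qv qw.
pose G : sgraph := disjoint_union X (K 2).
pose a : G := inl u; pose b : G := inl v.
pose c : G := inr (ord_max : 'I_2); pose d : G := inr (ord0 : 'I_2).
have sw : switchable a b c d.
  by rewrite /switchable /= qE // qu qv.
have XG : emb X G by exists inl => // x y [].
have [W FW WS] := DSF_find_switch dsfF sw FX XG.
pose lab (s : G) : nat := match s with
  | inl x => if x == u then 0 else if x == v then 1 else if q x then 5 else 4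
  | inr i => (2 + (i : 'I_2))%N end.
have lab_inl x : lab (inl x) \in [:: 0; 1; 4; 5].
  by rewrite /=; do 3!case: ifP => // _.
have lab_inr i : lab (inr i) \in [:: 2; 3].
  by rewrite /=; case: i => [[|[|i]] lt_i].
have mixed x i : @sedge (switch a b c d) (inl x) (inr i)
               = label_adj (lab (inl x)) (lab (inr i)).
  rewrite switchE //.
  have -> : on_cycle a b c d (inl x) (inr i)
          = (x == v) && (i == ord_max) || (x == u) && (i == ord0).
    by rewrite /on_cycle /same_pair /eq_op /= !andbF !orbF.
  rewrite [lab _]/=; have [->|xu] := eqVneq x u.
    by rewrite (negbTE uv) /=; case: i => [[|[|i]] lt_i].
  have [->|xv] := eqVneq x v; first by case: i => [[|[|i]] lt_i].
  by case: (q x); case: i => [[|[|i]] lt_i].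
have labS : @labelling (switch a b c d) lab.
  split=> [[x|i]|[x|i] [y|j] eq_l|[x|i] [y|j] ne].
  - by move: (lab_inl x); rewrite !inE => /or4P[] /eqP->.
  - by move: (lab_inr i); rewrite !inE => /orP[] /eqP->.
  - move: eq_l => /=.
    have [->|xu] := eqVneq x u; have [->|yu] := eqVneq y u.
    + by left.
    + by case: ifP => // _; case: ifP.
    + by case: ifP => // _; case: ifP.
    have [->|xv] := eqVneq x v; have [->|yv] := eqVneq y v.
    + by left.
    + by case: ifP.
    + by case: ifP.
    case: ifP => qx; case: ifP => qy // _; first by right.
    by left; rewrite (q1 x y) ?qx ?qy.
  - by have := lab_inl x; rewrite eq_l; move: (lab_inr j);
      rewrite !inE => /orP[] /eqP->.
  - by have := lab_inl y; rewrite -eq_l; move: (lab_inr i);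
      rewrite !inE => /orP[] /eqP->.
  - by left; congr inr; move: eq_l => /= /addnI/val_inj.
  - rewrite switchE //; have -> : on_cycle a b c d (inl x) (inl y) = same_pair u v x y.
      by rewrite /on_cycle /same_pair /eq_op /= !andbF !orbF.
    rewrite /= qE // /same_pair.
    have xy : x != y by apply: contraNneq ne => ->.
    have [xu|xu] := eqVneq x u; have [yu|yu] := eqVneq y u;
      rewrite ?xu ?yu /= in xy *.
    + by rewrite eqxx in xy.
    + rewrite qu [u == v](negbTE uv) /= orbF.
      by have [->|yv] := eqVneq y v; rewrite ?qv //=; case: (q y).
    + rewrite qu andbT [RHS]label_adj_sym.
      by have [->|xv] := eqVneq x v; rewrite ?qv //=; case: (q x).
    + rewrite andbF addbF.
      have [xv|xv] := eqVneq x v; have [yv|yv] := eqVneq y v;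
        rewrite ?xv ?yv in xy *.
      * by rewrite eqxx in xy.
      * by rewrite qv; case: (q y).
      * by rewrite qv; case: (q x).
      * by case: (q x); case: (q y).
  - exact: mixed.
  - by rewrite sedge_sym label_adj_sym mixed.
  - rewrite switchE //; case: i ne => [[|[|i]] lt_i] //;
      case: j => [[|[|j]] lt_j] //.
exists W; split=> //.
  by apply: (moved_edge_emb WS); exists lab.
move=> XW; have [f f_inj fE] := emb_trans XW WS.
have [lab6 lab_inj labE] := labS.
(* A vertex of the clique has two neighbours, so its image is not one of the
   three vertices of degree at most one. *)
have no_nbr m : label_adj 4 m = false by rewrite /label_adj /= andbF.
have nbr2 m : label_adj 2 m -> m = 0 by rewrite /label_adj /= andbF /= ?orbF => /eqP.
have nbr3 m : label_adj 3 m -> m = 1 by rewrite /label_adj /= andbF /= ?orbF => /eqP.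
have others x : q x -> exists y z, [/\ label_adj (lab (f x)) (lab (f y)),
    label_adj (lab (f x)) (lab (f z)) & y != z].
  have nbr y : q x -> q y -> x != y -> label_adj (lab (f x)) (lab (f y)).
    by move=> qx qy xy; rewrite -labE ?(inj_eq f_inj) // fE qE ?qx.
  move=> qx; have [xu|xu] := eqVneq x u; first subst x.
    by exists v, w; split=> //; apply: nbr; rewrite // eq_sym.
  have [xv|xv] := eqVneq x v; last by exists u, v; split=> //; apply: nbr.
  by exists u, w; split; [apply: nbr|apply: nbr; rewrite ?xv|rewrite eq_sym].
have f_q x : q x -> exists2 y, q y & f x = inl y.
  case/others=> y [z [+ + yz]]; case def_fx: (f x) => [t|i].
    have [qt|nqt] := boolP (q t); first by exists t.
    rewrite [lab _]/= (negbTE nqt); case: eqVneq nqt => [->|_]; rewrite ?qu //.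
    by case: eqVneq => [->|_]; rewrite ?qv // no_nbr.
  have same m : m < 5 -> lab (f y) = m -> lab (f z) = m -> False.
    move=> m5 ey ez; have [/f_inj/eqP|] := lab_inj (f y) (f z) (etrans ey (esym ez)).
      by rewrite (negbTE yz).
    by rewrite ey => m_5; rewrite m_5 in m5.
  have := lab_inr i; rewrite !inE => /orP[] /eqP->.
    by move=> /nbr2 ey /nbr2 ez; case: (same 0).
  by move=> /nbr3 ey /nbr3 ez; case: (same 1).
(* By counting, the clique is mapped onto itself, so both [u] and [v] are images of clique
   vertices. *)
have sub : f @: [set x | q x] = [set (inl y : G) | y in [set y | q y]].
  apply/eqP; rewrite eqEcard !card_imset //; last by move=> x y [].
  rewrite leqnn andbT; apply/subsetP => s /imsetP[x]; rewrite inE => /f_q[y qy ->] ->.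
  by apply/imsetP; exists y; rewrite ?inE.
have /imsetP[x /[!inE] qx fx] : a \in f @: [set x | q x].
  by rewrite sub; apply/imsetP; exists u; rewrite ?inE.
have /imsetP[y /[!inE] qy fy] : b \in f @: [set x | q x].
  by rewrite sub; apply/imsetP; exists v; rewrite ?inE.
have ab : a != b by apply: contraNneq uv => -[->].
have xy : x != y by apply: contraNneq ab => xy; rewrite fx fy xy.
have := fE x y; rewrite qE // qx qy -fx -fy labE //=.
by rewrite eqxx eq_sym (negbTE uv) eqxx.
Qed.

(** ** Reduction to finitely many starting points *)

Definition overlap X :=
  (star_forest X \/ biclique X) /\
  (star_forest (complement X) \/ biclique (complement X)).

(** The pigeonhole form of having three elements; unlike a list of them, it passes directly to
    [compl_set F]. *)
Definition at_most_three (F : graph_set) := forall X Y Z W,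
  F X -> F Y -> F Z -> F W -> ~ iso X Y -> ~ iso X Z -> ~ iso Y Z ->
  [\/ iso W X, iso W Y | iso W Z].

Definition near_base W := emb W (cgraph base) /\
  [\/ star_forest W, biclique W | emb W (complement (cgraph base))].

Lemma complement_iso_iff X Y : iso (complement X) Y -> iso X (complement Y).
Proof.
move=> XY; apply: iso_trans (iso_sym (complementK X)) _.
exact: complement_iso.
Qed.

Lemma moved_edge_base W : moved_edge W ->
    [\/ star_forest W, biclique W | moved_edge (complement W)] -> near_base W.
Proof.
move=> mW cases; have [g gW] := mW; split.
  apply: (labelling_base gW).
  case: cases; first exact: (star_forest_core gW).
    exact: (biclique_core gW).
  exact: (compl_core gW).
case: cases => [sW|bW|mcW]; [by constructor 1|by constructor 2|constructor 3].
apply: emb_trans (iso_emb (iso_sym (complementK W))) _; apply: complement_emb.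
have [h hW] := mcW; apply: (labelling_base hW); apply: (compl_core hW).
exact: moved_edge_emb (iso_emb (complementK W)) mW.
Qed.

Lemma start_clique F X : DSF F -> at_most_three F ->
    (forall Y, F Y -> ~ overlap Y) -> F X ->
    star_forest (complement X) -> biclique (complement X) ->
  exists2 W, F W \/ F (complement W) & near_base W.
Proof.
move=> dsfF F3 noF FX sX bX.
have nsX : ~ star_forest X by move=> sX'; apply: (noF X FX); split; left.
have [W [FW mW XW]] := DSF_moved_edge dsfF FX sX bX nsX.
have [Y1 FY1 sY1] := DSF_star_forest dsfF FX.
have [Y3 FY3 bY3] := DSF_biclique dsfF FX.
have iso_XW : ~ iso X W by move/iso_emb.
have [[sW|bW]|noW] := classic (star_forest W \/ biclique W).
- by exists W; [left|apply: moved_edge_base mW _; constructor 1].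
- by exists W; [left|apply: moved_edge_base mW _; constructor 2].
have XY1 : ~ iso X Y1 by move=> /iso_emb/star_forest_emb/(_ sY1).
have XY3 : ~ iso X Y3.
  move=> /iso_emb/biclique_emb/(_ bY3) bX'.
  by apply: (noF X FX); split; [right|left].
have WY1 : ~ iso W Y1.
  by move=> /iso_emb/star_forest_emb/(_ sY1) sW; apply: noW; left.
have WY3 : ~ iso W Y3.
  by move=> /iso_emb/biclique_emb/(_ bY3) bW; apply: noW; right.
have Y31 : iso Y3 Y1.
  by have [/iso_sym|/iso_sym|] := F3 _ _ _ _ FX FW FY1 FY3 iso_XW XY1 WY1.
have bY1 : biclique Y1 by apply: biclique_emb (iso_emb (iso_sym Y31)) bY3.
have cY1 := iso_emb (complementK Y1).
have [] := @DSF_moved_edge (compl_set F) (complement Y1).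
- exact: DSF_compl.
- exact/compl_setP.
- exact: star_forest_emb cY1 sY1.
- exact: biclique_emb cY1 bY1.
- move=> scY1; apply: (noF Y1 FY1); split; by left.
move=> V [/= FV mV YV].
(* [complement V] is a member. If it is [X], then [V] is a star forest; if it is [W], then [W] and
   its complement both have a moved edge; [YV] rules out [Y1]. *)
have [VX|VX|VX] := F3 _ _ _ _ FX FW FY1 FV iso_XW XY1 WY1.
- exists V; first by right.
  apply: moved_edge_base mV _; constructor 1.
  apply: star_forest_emb sX; apply: iso_emb; exact: complement_iso_iff.
- exists W; first by left.
  apply: moved_edge_base mW _; constructor 3.
  by apply: moved_edge_emb mV; apply/iso_emb/iso_sym; apply: complement_iso_iff.
by case: YV; apply/iso_emb/iso_sym; apply: complement_iso_iff.
Qed.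

(** Without overlap, a member in one of the first two families differs from one in the complementary
    two. So either [Y1] and [Y3] agree, or they and [complement Y2] are all three members and
    [complement Y4] must agree with [complement Y2]. Up to complementation both cases are
    [start_clique]. *)
Lemma start F X : DSF F -> at_most_three F -> F X ->
  (exists2 W, F W & overlap W) \/
  exists2 W, F W \/ F (complement W) & near_base W.
Proof.
move=> dsfF F3 FX; have [|no] := classic (exists2 W, F W & overlap W); first by left.
right; have noF Y : F Y -> ~ overlap Y by move=> FY oY; apply: no; exists Y.
have dsfC := DSF_compl dsfF; have FcX : compl_set F (complement X) by apply/compl_setP.
have [Y1 FY1 sY1] := DSF_star_forest dsfF FX.
have [Y2 FY2 sY2] := DSF_star_forest dsfC FcX.
have [Y3 FY3 bY3] := DSF_biclique dsfF FX.
have [Y4 FY4 bY4] := DSF_biclique dsfC FcX.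
have [Y13|nY13] := classic (iso Y1 Y3).
  have bY1 : biclique Y1 by apply: biclique_emb (iso_emb Y13) bY3.
  have cY1 := iso_emb (complementK Y1).
  have [] := @start_clique (compl_set F) (complement Y1).
  - exact: dsfC.
  - move=> A B D E /= FA FB FD FE AB AD BD.
    have nc P Q : ~ iso P Q -> ~ iso (complement P) (complement Q).
      move=> PQ /complement_iso_iff QP; apply: PQ.
      exact: iso_trans QP (complementK Q).
    have cc P Q : iso (complement P) (complement Q) -> iso P Q.
      by move=> /complement_iso_iff QP; apply: iso_trans QP (complementK Q).
    have [] := F3 _ _ _ _ FA FB FD FE (nc _ _ AB) (nc _ _ AD) (nc _ _ BD).
    + by move/cc; constructor 1.
    + by move/cc; constructor 2.
    + by move/cc; constructor 3.
  - move=> Y /= FY [h1 h2]; apply: (noF _ FY); split=> //.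
    have E := iso_emb (complementK Y).
    by case: h1 => [/(star_forest_emb E)|/(biclique_emb E)]; [left|right].
  - exact/compl_setP.
  - exact: star_forest_emb cY1 sY1.
  - exact: biclique_emb cY1 bY1.
  move=> W FW bW; exists W => //; case: FW => [|/compl_setP]; first by right.
  by left.
have ccP Y := iso_emb (complementK Y).
have n12 : ~ iso Y1 (complement Y2).
  move=> /iso_emb E; apply: (noF Y1 FY1); split; left=> //.
  exact: star_forest_emb (emb_trans (complement_emb E) (ccP Y2)) sY2.
have n32 : ~ iso Y3 (complement Y2).
  move=> /iso_emb E; apply: (noF Y3 FY3); split; [by right|left].
  exact: star_forest_emb (emb_trans (complement_emb E) (ccP Y2)) sY2.
have [E|E|E] := F3 _ _ _ _ FY1 FY3 FY2 FY4 nY13 n12 n32.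
- case: (noF Y1 FY1); split; [by left|right].
  exact: biclique_emb (iso_emb (iso_sym (complement_iso_iff E))) bY4.
- case: (noF Y3 FY3); split; [by right|right].
  exact: biclique_emb (iso_emb (iso_sym (complement_iso_iff E))) bY4.
apply: (@start_clique F (complement Y2)) => //.
  exact: star_forest_emb (ccP Y2) sY2.
apply: biclique_emb bY4.
by apply/iso_emb/iso_sym; apply: complement_iso_iff.
Qed.

(** * The search *)

Definition code_k3 : code := [:: [::]; [:: 0]; [:: 0; 1]].
Definition code_p3 : code := [:: [::]; [:: 0]; [:: 1]].
Definition code_c4 : code := [:: [::]; [:: 0]; [:: 1]; [:: 0; 2]].
Definition code_k13 : code := [:: [::]; [:: 0]; [:: 0]; [:: 0]].
Definition code_k23 : code := [:: [::]; [::]; [:: 0; 1]; [:: 0; 1]; [:: 0; 1]].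
Definition code_2k2 : code := [:: [::]; [:: 0]; [::]; [:: 2]].
Definition code_p3k1 : code := [:: [::]; [:: 0]; [:: 1]; [::]].
Definition code_k3k1 : code := [:: [::]; [:: 0]; [:: 0; 1]; [::]].

Definition forcing_triples : seq (seq code) :=
  let ts := [:: [:: code_k3; code_k13; code_2k2];
                [:: code_k3; code_k13; code_p3k1];
                [:: code_k3; code_k23; code_p3k1];
                [:: code_k3; code_c4; code_p3k1];
                [:: code_k3k1; code_c4; code_p3k1]] in
  ts ++ map (map ccompl) ts.

(** These pairs are themselves degree-sequence-forcing, so a minimal triple contains none of them;
    they prune the search. *)
Definition forcing_pairs : seq (seq code) :=
  let co_p3 := ccompl code_p3 in
  [:: [:: ccompl code_k3; co_p3]; [:: ccompl code_k3; code_k3];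
      [:: co_p3; code_p3]; [:: co_p3; code_k13]; [:: co_p3; code_c4];
      [:: co_p3; code_k23]; [:: code_p3; code_k3]; [:: code_p3; code_k3k1];
      [:: code_p3; code_2k2]; [:: code_p3; ccompl code_k23];
      [:: code_2k2; code_c4]].

(* Found by computer search. In each graph the vertices 0, 1, 2, 3 admit a
   switch; the graph and the outcome of that switch are the counterexamples. *)
Definition switch_pool : seq code := [::
  [:: [::]; [:: 0]; [:: 0]; [:: 1;2]; [:: 1;2]];
  [:: [::]; [:: 0]; [::]; [:: 2]; [:: 2]; [:: 3]];
  [:: [::]; [:: 0]; [::]; [:: 2]; [:: 2;3]];
  [:: [::]; [:: 0]; [:: 0]; [:: 1;2]; [:: 2;3]];
  [:: [::]; [:: 0]; [::]; [:: 2]; [:: 0;1;2]; [:: 1;2;3]];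
  [:: [::]; [:: 0]; [:: 0]; [:: 1;2]; [:: 1;2]; [:: 0;1;2;3;4]];
  [:: [::]; [:: 0]; [::]; [:: 1;2]; [:: 2;3]];
  [:: [::]; [:: 0]; [:: 0]; [:: 1;2]; [:: 2]; [:: 3;4]];
  [:: [::]; [:: 0]; [::]; [:: 2]; [:: 1;2]];
  [:: [::]; [:: 0]; [::]; [:: 1;2]; [:: 1;2]];
  [:: [::]; [:: 0]; [::]; [:: 2]; [:: 3]; [:: 2;4]];
  [:: [::]; [:: 0]; [::]; [:: 2]; [:: 1]; [:: 2]];
  [:: [::]; [:: 0]; [::]; [:: 1;2]; [::]; [:: 1;2]];
  [:: [::]; [:: 0]; [:: 0]; [:: 1;2]; [:: 0;2;3]; [:: 1;2;3;4]];
  [:: [::]; [:: 0]; [:: 0]; [:: 1;2]; [:: 1;3]; [:: 3]; [:: 2;3;5]];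
  [:: [::]; [:: 0]; [::]; [:: 2]; [:: 3]; [:: 2;3;4]];
  [:: [::]; [:: 0]; [:: 0]; [:: 1;2]; [:: 0;1;2]; [:: 1;2;3]];
  [:: [::]; [:: 0]; [:: 0]; [:: 1;2]; [:: 1;2]; [:: 1;2;4]];
  [:: [::]; [:: 0]; [::]; [:: 2]; [::]; [:: 4]; [:: 2;3]];
  [:: [::]; [:: 0]; [::]; [:: 1;2]; [:: 2;3]; [:: 0;1;2;3;4]];
  [:: [::]; [:: 0]; [::]; [:: 2]; [:: 1;3]; [:: 1;2;3]; [:: 1;2;4;5]];
  [:: [::]; [:: 0]; [::]; [:: 2]; [:: 2;3]; [:: 2;3;4]; [:: 2;3;4;5]];
  [:: [::]; [:: 0]; [::]; [:: 2]; [:: 0;1;2]; [:: 1;2;3]; [:: 1;2;3;4;5]];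
  [:: [::]; [:: 0]; [:: 0]; [:: 1;2]; [::]; [::]; [:: 1;2]]].

Definition cstar (c : code) : bool :=
  let l := iota 0 (size c) in
  every (fun x => every (fun y => if adj c x y then
    every (fun z => if adj c y z then
      eqn x z ||| every (fun w => if adj c z w then eqn y w else true) l
    else true) l else true) l) l.

(** Complete bipartite and edgeless graphs are the graphs without an induced [K 3] or
    [K 2 + K 1]. *)
Definition cbiclique (c : code) : bool :=
  ~~ cembeds code_k3 c &&& ~~ cembeds (ccompl code_p3) c.

Definition coverlap (c : code) : bool :=
  let d := ccompl c in
  (cstar c ||| cbiclique c) &&& (cstar d ||| cbiclique d).

Definition covers_families (L : seq code) : bool :=
  let L' := map ccompl L in
  any cstar L &&& any cbiclique L &&& any cstar L' &&& any cbiclique L'.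

Definition refutes (L : seq code) (g : code) : bool :=
  let n := size g in let r := adj g in
  Nat.ltb 3 n &&& r 0 1 &&& r 2 3 &&& ~~ r 1 2 &&& ~~ r 3 0 &&&
  cfree L n r &&& ~~ cfree L n (nswitch r 0 1 2 3).

Definition undup_iso (L : seq code) : seq code :=
  foldr (fun c acc => if any (ciso c) acc then acc else c :: acc) [::] L.

Definition subcodes (g : code) : seq code :=
  undup_iso (map (csub g) (sublists (iota 0 (size g)))).

(** Graphs on at most two vertices force alone; a larger member containing [c] would be redundant; a
    forcing pair would be a proper forcing subset; a [c] completing the triple must leave no family
    unmet. The converse containment does not arise, since [c] comes from a graph free of [L]. *)
Definition excluded (L : seq code) (c : code) : bool :=
  Nat.ltb (size c) 3
  ||| any (fun a => Nat.ltb (size c) (size a) &&& cembeds c a) L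
  ||| any (fun p => every (fun a => any (ciso a) (c :: L)) p) forcing_pairs
  ||| (eqn (size L) 2 &&& ~~ covers_families (c :: L)).

Definition same_classes (L M : seq code) : bool :=
  every (fun c => any (ciso c) M) L &&& every (fun c => any (ciso c) L) M.

Definition pool_subcodes : seq (code * seq code) :=
  [seq (g, subcodes g) | g <- switch_pool].

(** [k] counts the members still to be found. At 0 the set [L] is complete, and a refutation is no
    longer a source of candidates but a contradiction. *)
Fixpoint search k (L : seq code) : bool :=
  if k is k'.+1 then
    any (fun p => refutes L p.1 &&&
      every (fun c => excluded L c ||| search k' (c :: L)) p.2) pool_subcodes
  else any (same_classes L) forcing_triples ||| any (refutes L) switch_pool.

Definition small_overlaps : seq code :=
  [:: code_p3; ccompl code_p3; code_2k2; code_c4].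

Definition near_codes : seq code :=
  [seq c <- subcodes base | Nat.ltb 2 (size c) &&&
     (cstar c ||| cbiclique c ||| cembeds c (ccompl base))].

Definition starting_points : seq code :=
  undup_iso (small_overlaps ++ near_codes ++ map ccompl near_codes).

(** * Soundness of the tests *)

Lemma any_ciso c L G : any (ciso c) L -> iso G (cgraph c) ->
  exists2 d, d \in L & iso G (cgraph d).
Proof.
rewrite anyE => /hasP[d dL /cisoP cd] Gc.
by exists d => //; apply: iso_trans Gc cd.
Qed.

Lemma ciso_refl c : ciso c c. Proof. exact/cisoP/iso_refl. Qed.

Lemma undup_isoP L c : c \in L -> any (ciso c) (undup_iso L).
Proof.
elim: L => //= d L IHL; rewrite inE => /orP[/eqP->|/IHL cL].
  by case: ifP => //=; rewrite ciso_refl.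
by case: ifP => //=; rewrite cL; case: ifP.
Qed.

Lemma starting_pointsP c :
  c \in small_overlaps ++ near_codes ++ map ccompl near_codes ->
  any (ciso c) starting_points.
Proof. by move=> c_in; rewrite /starting_points; apply: undup_isoP. Qed.

Lemma subcodesP W g : emb W (cgraph g) ->
  exists2 c, c \in subcodes g & iso W (cgraph c).
Proof.
case/emb_csub=> s sg Ws; apply: any_ciso Ws; apply: undup_isoP.
exact: map_f.
Qed.

(** The boolean tests serve to discard candidates, so soundness rests on this direction. *)
Lemma cstarP c : star_forest (cgraph c) -> cstar c.
Proof.
move=> st; rewrite /cstar everyE; apply/allP => x; rewrite mem_iota => /= lt_x.
rewrite everyE; apply/allP => y; rewrite mem_iota => /= lt_y; case: ifP => // xy.
rewrite everyE; apply/allP => z; rewrite mem_iota => /= lt_z; case: ifP => // yz.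
rewrite -[eqn x z]/(x == z); case: eqVneq => // xz.
rewrite everyE; apply/allP => w; rewrite mem_iota => /= lt_w; case: ifP => // zw.
have [[/eqP]|[yw]] :=
  st (Ordinal lt_x) (Ordinal lt_y) (Ordinal lt_z) (Ordinal lt_w) xy yz zw.
  by rewrite (negbTE xz).
by rewrite yw -[eqn _ _]/(_ == _) eqxx.
Qed.

Lemma cbicliqueP c : biclique (cgraph c) -> cbiclique c.
Proof.
move=> bc; rewrite /cbiclique; case: ifP.
  move=> _; apply/negP => /embedsP/biclique_emb/(_ bc) [f fE].
  have := (fE (@Ordinal 3 0 isT) (@Ordinal 3 1 isT),
           fE (@Ordinal 3 0 isT) (@Ordinal 3 2 isT),
           fE (@Ordinal 3 1 isT) (@Ordinal 3 2 isT)).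
  by move=> [[]] /=; case: (f _) (f _) (f _) => [] [] [].
move/negbT/negPn=> /embedsP/biclique_emb/(_ bc) [f fE].
have := (fE (@Ordinal 3 0 isT) (@Ordinal 3 1 isT),
         fE (@Ordinal 3 0 isT) (@Ordinal 3 2 isT),
         fE (@Ordinal 3 1 isT) (@Ordinal 3 2 isT)).
by move=> [[]] /=; case: (f _) (f _) (f _) => [] [] [].
Qed.

Lemma ccompl_emb c W : iso W (cgraph c) -> emb (cgraph (ccompl c)) (complement W).
Proof.
move=> Wc; apply: emb_trans (iso_emb (ccompl_iso c)) _; apply: complement_emb.
exact/iso_emb/iso_sym.
Qed.

Lemma coverlapP c W : iso W (cgraph c) -> overlap W -> coverlap c.
Proof.
move=> Wc [h1 h2]; rewrite /coverlap /=.
have E1 := iso_emb (iso_sym Wc); have E2 := ccompl_emb Wc.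
have -> : cstar c ||| cbiclique c.
  case: h1 => [/(star_forest_emb E1)/cstarP->|/(biclique_emb E1)/cbicliqueP->] //.
  by case: ifP.
case: h2 => [/(star_forest_emb E2)/cstarP->|/(biclique_emb E2)/cbicliqueP->] //.
by case: ifP.
Qed.

Lemma overlap_emb A B : emb A B -> overlap B -> overlap A.
Proof.
move=> AB; have cAB := complement_emb AB.
case=> h1 h2; split.
  by case: h1 => [/(star_forest_emb AB)|/(biclique_emb AB)]; [left|right].
by case: h2 => [/(star_forest_emb cAB)|/(biclique_emb cAB)]; [left|right].
Qed.

(** [overlap] is hereditary, so excluding it on five vertices excludes it on all larger graphs. *)
Lemma no_large_overlap : every (fun c => ~~ coverlap c) (codes 5).
Proof. by vm_cast_no_check (erefl true). Qed.

Lemma small_overlap_check :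
  every (fun c => if coverlap c then any (ciso c) small_overlaps else true)
        (codes 3 ++ codes 4).
Proof. by vm_cast_no_check (erefl true). Qed.

Lemma overlap_small W : overlap W -> 2 < #|W| ->
  exists2 c, c \in small_overlaps & iso W (cgraph c).
Proof.
move=> oW gt2; have [le4|gt4] := leqP #|W| 4.
  have [c c_in Wc] := iso_code W.
  have := small_overlap_check; rewrite everyE => /allP/(_ c).
  rewrite (coverlapP Wc oW) => chk; apply: any_ciso Wc; apply: chk.
  by rewrite mem_cat; move: gt2 le4 c_in;
      case: #|W| => [|[|[|[|[|]]]]] // _ _ ->; rewrite ?orbT.
pose S := [set x in take 5 (enum W)].
have cardS : #|induced S| = 5.
  rewrite card_sig /= -[RHS](size_takel (s := enum W)) -?cardE //.
  by rewrite cardsE; apply/card_uniqP; rewrite take_uniq // enum_uniq.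
have [c c_in Sc] := iso_code (induced S).
have SW : emb (induced S) W by apply/emb_induced; exists S; apply: iso_refl.
have := no_large_overlap; rewrite everyE => /allP/(_ c).
by rewrite (coverlapP Sc (overlap_emb SW oW)) -cardS => /(_ c_in).
Qed.

Lemma refutes_find F L g : DSF F -> (forall c, c \in L -> F (cgraph c)) ->
    refutes L g ->
  exists W, [/\ F W, emb W (cgraph g)
              & forall c, c \in L -> ~ emb (cgraph c) (cgraph g)].
Proof.
move=> dsfF FL; rewrite /refutes ltbE.
case: ltnP => //= lt3; case g01: (adj g 0 1) => //=; case g23: (adj g 2 3) => //=.
case g12: (adj g 1 2) => //=; case g30: (adj g 3 0) => //=.
rewrite /cfree !anyE; case: hasP => //= fr /negPn/hasP[c cL c_emb].
have x0 : cgraph g by exact: (Ordinal (ltn_trans (isT : 0 < 3) lt3)).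
pose h : nat -> cgraph g := cvertex x0.
have [h_inj hE] := cvertex_models x0.
have h_eq i j : i < size g -> j <= 3 -> (i == j) = (h i == h j).
  move=> lt_i le_j; apply/eqP/eqP => [->//|]; apply: h_inj => //.
  exact: (leq_ltn_trans le_j lt3).
have lt_g i : i <= 3 -> i \in gtn (size g) by move=> le_i;
    apply: (leq_ltn_trans le_i lt3).
have sw : switchable (h 0) (h 1) (h 2) (h 3).
  by rewrite /switchable !hE ?lt_g // g01 g23 g12 g30 -!h_eq // (leq_ltn_trans _ lt3).
have [|W FW Wg] := DSF_switch_find dsfF sw (FL c cL).
  apply: (@embeds_sound c (size g) (nswitch (adj g) 0 1 2 3) (switch (h 0) (h
      1) (h 2) (h 3)) h) c_emb.
  split=> // i j lt_i lt_j; rewrite nswitchE switchE // hE //.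
  by rewrite /on_cycle /same_pair !h_eq.
exists W; split=> // d dL dg; apply: fr; exists d => //; exact/embedsP.
Qed.

Lemma DSF_eq (F1 F2 : graph_set) : gset_eq F1 F2 -> DSF F1 -> DSF F2.
Proof.
move=> F12 /DSF_degree dsf1; apply/DSF_degree => G H GH /freeE frG.
have /freeE frH : free F1 H.
  by apply: dsf1 GH _; apply/freeE => A /F12; apply: frG.
by apply/freeE => A /F12; apply: frH.
Qed.

Lemma or_else3 (b1 b2 b3 : bool) : [\/ b1, b2 | b3] -> b1 ||| b2 ||| b3.
Proof. by case: b1 b2 => [] [] // []. Qed.

Lemma mem_cat3 (T : eqType) (x : T) s1 s2 s3 :
  [\/ x \in s1, x \in s2 | x \in s3] -> x \in s1 ++ s2 ++ s3.
Proof. by rewrite !mem_cat => -[] ->; rewrite ?orbT. Qed.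

(** * Finite checks by computation *)

Lemma small_sets_check :
  every (fun c => check_DSF [:: c]) (codes 0 ++ codes 1 ++ codes 2).
Proof. by vm_cast_no_check (erefl true). Qed.

Lemma forcing_pairs_check : every check_DSF forcing_pairs.
Proof. by vm_cast_no_check (erefl true). Qed.

Lemma forcing_triples_check : every check_DSF forcing_triples.
Proof. by vm_cast_no_check (erefl true). Qed.

Lemma forcing_pairs_size : all (fun p => size p == 2) forcing_pairs.
Proof. by []. Qed.

Lemma search_check : every (fun c => search 2 [:: c]) starting_points.
Proof. by vm_cast_no_check (erefl true). Qed.

(** Sublists of length 0 and 3 are the empty and the whole set. Any other one is not forcing, as
    some pool graph is free of it while a switch of that graph is not. *)
Definition minimal_check (t : seq code) : bool :=
  pairwise (fun a b => ~~ ciso a b) t &&& eqn (size t) 3 &&&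
  every (fun M => eqn (size M) 0 ||| eqn (size M) 3 |||
                  any (refutes M) switch_pool) (sublists t).

Lemma forcing_triples_minimal : every minimal_check forcing_triples.
Proof. by vm_cast_no_check (erefl true). Qed.

(** * Members of a minimal triple *)

Section Classification.
Variable F : graph_set.
Hypotheses (Fmin : minimal_DSF F) (F3 : has_three_elements F).

Let dsfF : DSF F. Proof. by case: Fmin. Qed.

Lemma triple_at_most_three : at_most_three F.
Proof.
have [A [B [D [_ _ _ FE]]]] := F3.
have swap P Q R : iso P R -> iso Q R -> iso P Q.
  by move=> PR /iso_sym; apply: iso_trans.
move=> X Y Z W /FE X3 /FE Y3 /FE Z3 /FE W3 XY XZ YZ.
by case: X3 => X3; case: Y3 => Y3; try (by case: XY; apply: swap X3 Y3);
  case: Z3 => Z3; try (by case: XZ; apply: swap X3 Z3);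
  try (by case: YZ; apply: swap Y3 Z3);
  case: W3 => W3;
  first [ by constructor 1; apply: swap W3 X3 | by constructor 2; apply: swap W3 Y3
        | by constructor 3; apply: swap W3 Z3 ].
Qed.

(** If [B] were larger, every graph containing [B] would contain [A]. Removing the class of [B]
    would then leave freeness unchanged, and the smaller set, which still has [A], would be
    forcing. *)
Lemma minimal_emb A B : F A -> F B -> emb A B -> #|B| <= #|A|.
Proof.
move=> FA FB AB; rewrite leqNgt; apply/negP => ltAB; have [_ Fm] := Fmin.
have rem_iso G H : iso G H -> F G /\ ~ iso G B -> F H /\ ~ iso H B.
  move=> GH [FG nGB]; split=> [|HB]; first exact: gset_iso GH FG.
  by apply: nGB; apply: iso_trans GH HB.
pose F' := GraphSet rem_iso.
have F'A : F' A by split=> // /iso_card eqAB; rewrite eqAB ltnn in ltAB.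
have freeF' G : free F' G <-> free F G.
  split=> /freeE fr; apply/freeE => H; last by case=> FH _; apply: fr.
  move=> FH HG; have [HB|nHB] := classic (iso H B); last exact: fr HG.
  apply: fr F'A _; apply: emb_trans AB _; apply: emb_trans HG.
  exact/iso_emb/iso_sym.
apply: (Fm F'); first by exists A.
  by split=> [G []|/(_ B FB) [_]] //; apply; apply: iso_refl.
move/DSF_degree: dsfF => dsfF'; apply/DSF_degree => G H GH /freeF' frG.
by apply/freeF'; apply: dsfF' frG.
Qed.

Lemma three_not_two M : size M <= 2 -> ~ gset_sub F (cset M).
Proof.
have [A [B [D [AB AD BD FE]]]] := F3.
have swap P Q R : iso P R -> iso Q R -> iso P Q.
  by move=> PR /iso_sym; apply: iso_trans.
move=> sz sub.
have inM W : [\/ iso W A, iso W B | iso W D] -> exists2 c, c \in M & iso W (cgraph c).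
  by move/FE/sub.
have [a aM Aa] := inM A (Or31 _ _ (iso_refl A)).
have [b bM Bb] := inM B (Or32 _ _ (iso_refl B)).
have [d dM Dd] := inM D (Or33 _ _ (iso_refl D)).
have ab : a != b by apply/eqP => ab; apply: AB; apply: swap Aa _; rewrite ab.
have ad : a != d by apply/eqP => ad; apply: AD; apply: swap Aa _; rewrite ad.
have bd : b != d by apply/eqP => bd; apply: BD; apply: swap Bb _; rewrite bd.
have : size [:: a; b; d] <= size M.
  apply: uniq_leq_size; first by rewrite /= !inE negb_or ab ad bd.
  by move=> c; rewrite !inE => /or3P[] /eqP->.
by rewrite leqNgt ltnS sz.
Qed.

Lemma no_forcing_subset M : 0 < size M <= 2 -> check_DSF M ->
  ~ (forall c, c \in M -> F (cgraph c)).
Proof.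
case/andP=> M0 M2 /check_DSF_sound dsfM FM; have [_ Fm] := Fmin.
have subM : gset_sub (cset M) F.
  by move=> G [c /FM Fc /iso_sym cG]; apply: gset_iso cG Fc.
apply: (Fm (cset M)) => //; last by split=> //; apply: three_not_two.
case: M M0 {M2 dsfM FM subM} => // c M _; exists (cgraph c), c; rewrite ?mem_head //.
exact: iso_refl.
Qed.

Lemma member_card_gt2 W : F W -> 2 < #|W|.
Proof.
move=> FW; rewrite ltnNge; apply/negP => le2.
have [c c_in Wc] := iso_code W.
have Fc : F (cgraph c) by apply: gset_iso Wc FW.
apply: (@no_forcing_subset [:: c]) => // [|d]; last by rewrite inE => /eqP->.
have := small_sets_check; rewrite everyE => /allP; apply.
rewrite !mem_cat; move: le2 c_in.
by case: #|W| => [|[|[|]]] // _ ->; rewrite ?orbT.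
Qed.

Definition independent (L : seq code) :=
  (forall c, c \in L -> F (cgraph c)) /\ pairwise (fun a b => ~~ ciso a b) L.

Lemma independent3 L W : independent L -> size L = 3 -> F W ->
  exists2 c, c \in L & iso W (cgraph c).
Proof.
case: L => [|a [|b [|d []]]] // [FL /= /and3P[/and3P[ab ad _] /andP[bd _] _]] _ FW.
have nc p q : ~~ ciso p q -> ~ iso (cgraph p) (cgraph q).
  by move/negP=> npq /cisoP.
have Fa : F (cgraph a) by apply: FL; rewrite !inE eqxx.
have Fb : F (cgraph b) by apply: FL; rewrite !inE eqxx orbT.
have Fd : F (cgraph d) by apply: FL; rewrite !inE eqxx !orbT.
have [Wa|Wb|Wd] := triple_at_most_three Fa Fb Fd FW (nc _ _ ab) (nc _ _ ad) (nc _ _ bd).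
- by exists a; rewrite // !inE eqxx.
- by exists b; rewrite // !inE eqxx orbT.
- by exists d; rewrite // !inE eqxx !orbT.
Qed.

Lemma independent_covers L : independent L -> size L = 3 -> covers_families L.
Proof.
move=> indL sz; have [c0 c0L] : exists c, c \in L.
  by case: L sz {indL} => // c L _; exists c; apply: mem_head.
have Fc0 : F (cgraph c0) by case: indL => FL _; apply: FL.
have dsfC := DSF_compl dsfF.
have FcC : compl_set F (complement (cgraph c0)) by apply/compl_setP.
rewrite /covers_families /= !anyE.
have [Y1 FY1 /star_forest_emb sY1] := DSF_star_forest dsfF Fc0.
have [Y2 FY2 /star_forest_emb sY2] := DSF_star_forest dsfC FcC.
have [Y3 FY3 /biclique_emb bY3] := DSF_biclique dsfF Fc0.
have [Y4 FY4 /biclique_emb bY4] := DSF_biclique dsfC FcC.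
have compl_emb Y c : iso (complement Y) (cgraph c) -> emb (cgraph (ccompl c)) Y.
  by move/ccompl_emb => E; apply: emb_trans E (iso_emb (complementK Y)).
have -> : has cstar L.
  have [c cL /iso_sym/iso_emb/sY1/cstarP st] := independent3 indL sz FY1.
  by apply/hasP; exists c.
have -> : has cbiclique L.
  have [c cL /iso_sym/iso_emb/bY3/cbicliqueP st] := independent3 indL sz FY3.
  by apply/hasP; exists c.
have -> : has cstar (map ccompl L).
  have [c cL /compl_emb/sY2/cstarP st] := independent3 indL sz FY2.
  by apply/hasP; exists (ccompl c); rewrite ?map_f.
have [c cL /compl_emb/bY4/cbicliqueP st] := independent3 indL sz FY4.
by apply/hasP; exists (ccompl c); rewrite ?map_f.
Qed.

Lemma excludedF L c : independent (c :: L) -> size L <= 2 -> ~~ excluded L c.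
Proof.
move=> indL szL; have [FL _] := indL; have Fc := FL c (mem_head _ _).
rewrite /excluded ltbE.
have -> : (size c < 3) = false.
  by have := member_card_gt2 Fc; rewrite card_ord ltnNge => /negbTE.
have -> : any (fun a => Nat.ltb (size c) (size a) &&& cembeds c a) L = false.
  rewrite anyE; apply/hasP => -[a aL]; rewrite ltbE; case: ltnP => // lt_ca.
  move/embedsP=> /(minimal_emb Fc); rewrite !card_ord leqNgt lt_ca => /(_ _)/negP.
  by case=> //; apply: FL; rewrite inE aL orbT.
have -> : any (fun p => every (fun a => any (ciso a) (c :: L)) p) forcing_pairs = false.
  rewrite anyE; apply/hasP => -[p p_in]; rewrite everyE => /allP pL.
  have sz2 := allP forcing_pairs_size _ p_in.
  apply: (@no_forcing_subset p); first by rewrite (eqP sz2).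
    by have := forcing_pairs_check; rewrite everyE => /allP; apply.
  move=> a /pL; rewrite anyE => /hasP[b /FL Fb /cisoP/iso_sym ba].
  exact: gset_iso ba Fb.
rewrite /= -[eqn _ _]/(_ == _); case: eqP => //= sz2.
by rewrite negbK; apply: independent_covers; rewrite //= sz2.
Qed.

Lemma search0 L :
  search 0 L = any (same_classes L) forcing_triples ||| any (refutes L) switch_pool.
Proof. by []. Qed.

Lemma searchS k L : search k.+1 L = any (fun p => refutes L p.1 &&&
  every (fun c => excluded L c ||| search k (c :: L)) p.2) pool_subcodes.
Proof. by []. Qed.

(** For [k = 0] the three codes of [L] exhaust [F]. A refuting graph would then contain a member of
    [F], which is one of [L], although the graph is free of [L]. *)
Lemma search_sound k L : size L + k = 3 -> independent L -> search k L ->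
  exists2 t, t \in forcing_triples & gset_eq F (cset t).
Proof.
elim: k L => [|k IHk] L sz indL; have [FL pwL] := indL.
  rewrite addn0 in sz; rewrite search0 !anyE;
      case: hasP => [[t t_in same] _|_ /hasP[g _]].
    exists t => //; move: same; rewrite /same_classes !everyE.
    case: allP => // Lt /allP tL G; split=> [/(independent3 indL sz)[c /Lt]|[c /tL]].
      exact: any_ciso.
    rewrite anyE => /hasP[d /FL Fd /cisoP cd] Gc.
    by apply: gset_iso Fd; apply/iso_sym/(iso_trans Gc).
  case/(refutes_find dsfF FL)=> W [FW Wg noL].
  have [c cL /iso_sym/iso_emb cW] := independent3 indL sz FW.
  by case: (noL c cL); apply: emb_trans cW Wg.
rewrite searchS anyE => /hasP[p /mapP[g _ ->]].
rewrite [(g, _).1]/= [(g, _).2]/=; case: ifP => // ref.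
have [W [FW Wg noL]] := refutes_find dsfF FL ref.
have [c c_in Wc] := subcodesP Wg.
(* [c] lies in a graph free of [L], hence is isomorphic to no code of [L]: each refutation yields a
   new member. *)
have indcL : independent (c :: L).
  split=> [d|/=].
    by rewrite inE => /orP[/eqP->|/FL//]; apply: gset_iso Wc FW.
  rewrite pwL andbT; apply/allP => d dL; apply/negP => /cisoP/iso_sym/iso_emb dc.
  apply: (noL d dL); apply: emb_trans dc _; apply: emb_trans Wg.
  exact/iso_emb/iso_sym.
rewrite everyE => /allP/(_ c c_in); case: ifP => [exc|_].
  have := excludedF indcL; rewrite exc => /(_ _)/negP; case=> //.
  by rewrite -ltnS -sz addnS ltnS leq_addr.
by apply: IHk; rewrite //= addSnnS.
Qed.

Lemma classification : exists2 t, t \in forcing_triples & gset_eq F (cset t).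
Proof.
have [A [B [D [_ _ _ FE]]]] := F3.
have FA : F A by apply/FE; constructor 1; apply: iso_refl.
have from c : c \in small_overlaps ++ near_codes ++ map ccompl near_codes ->
    F (cgraph c) -> exists2 t, t \in forcing_triples & gset_eq F (cset t).
  move=> /starting_pointsP c_in Fc.
  have [d d_in cd] := any_ciso c_in (iso_refl (cgraph c)).
  have Fd : F (cgraph d) by apply: gset_iso cd Fc.
  have indd : independent [:: d].
    by split; [move=> b; rewrite inE => /eqP->; exact: Fd | exact: isT].
  have := search_check; rewrite everyE => /allP/(_ d d_in).
  exact: (@search_sound 2 [:: d] erefl indd).
have [[W FW oW]|[W FW [Wb cases]]] := start dsfF triple_at_most_three FA.
  have [c c_in Wc] := overlap_small oW (member_card_gt2 FW).
  by apply: (from c); [apply/mem_cat3/Or31 | exact: gset_iso Wc FW].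
have [c c_in Wc] := subcodesP Wb.
have gt2 : 2 < size c.
  rewrite -[size c]card_ord -(iso_card Wc : _ = #|'I__|).
  by case: FW => [/member_card_gt2|/member_card_gt2].
have c_case : cstar c ||| cbiclique c ||| cembeds c (ccompl base).
  have cW := iso_emb (iso_sym Wc).
  case: cases => [/(star_forest_emb cW)/cstarP|/(biclique_emb cW)/cbicliqueP|Wcb].
  - by move=> h; apply/or_else3/Or31.
  - by move=> h; apply/or_else3/Or32.
  apply/or_else3/Or33/embedsP; apply: emb_trans cW _; apply: emb_trans Wcb _.
  exact/iso_emb/iso_sym/ccompl_iso.
have c_near : c \in near_codes.
  by rewrite mem_filter; apply/andP; split; [rewrite ltbE gt2;
      exact: c_case | exact: c_in].
case: FW => [FW|FcW].
  apply: (from c); last exact: gset_iso Wc FW.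
  exact/mem_cat3/Or32.
apply: (from (ccompl c)).
  exact/mem_cat3/Or33/map_f.
apply: gset_iso FcW; apply: iso_trans (complement_iso Wc) _.
exact/iso_sym/ccompl_iso.
Qed.

End Classification.

(** * Minimality of the ten triples *)

(** A subset of a triple is an arbitrary predicate on graphs; making it boolean on the three codes
    turns it into a sublist, to which the computed check applies. *)
Lemma classical_pred (T : eqType) (Q : T -> Prop) (s : seq T) :
  exists p : pred T, forall x, x \in s -> p x <-> Q x.
Proof.
elim: s => [|x s [p pE]]; first by exists xpred0.
have [Qx|nQx] := classic (Q x).
  exists (predU1 x p) => y; rewrite inE /=; case: eqVneq => [->|_] //=; exact: pE.
exists (predD1 p x) => y; rewrite inE /=; case: eqVneq => [->|_] //=; exact: pE.
Qed.

Lemma forcing_triple_minimal F t : t \in forcing_triples ->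
  gset_eq F (cset t) -> minimal_DSF_triple F.
Proof.
move=> t_in FE.
have dsft : DSF (cset t).
  apply: check_DSF_sound; have := forcing_triples_check; rewrite everyE => /allP.
  exact.
have dsfF : DSF F by apply: DSF_eq dsft => G; rewrite FE.
have := forcing_triples_minimal; rewrite everyE => /allP/(_ t t_in).
rewrite /minimal_check; case pw: pairwise => //; case: eqnP => // sz.
rewrite everyE => /allP min_t.
split; [split=> // F' [G0 F'G0] [sub nsub] dsfF'|].
  have [p pE] := classical_pred (fun c => F' (cgraph c)) t.
  have := min_t _ (filter_sublists p t).
  have [c0 c0t p0] : exists2 c, c \in t & p c.
    have /sub/FE [c ct Gc] := F'G0; exists c => //.
    by apply/pE => //; apply: gset_iso Gc F'G0.
  case: eqnP => [/size0nil/eqP|_].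
    by rewrite -[_ == _]negbK -has_filter; case: hasP => // -[]; exists c0.
  case: eqnP => [szp|_].
    (* A sublist of length three is all of [t], so the subset would not be proper. *)
    case: nsub => G /FE[c ct Gc]; apply: gset_iso (iso_sym Gc) _; apply/pE => //.
    suff /all_filterP/allP : filter p t = t by apply.
    by apply/eqP; rewrite -(size_subseq_leqif (filter_subseq p t)) szp sz.
  rewrite anyE => /hasP[g _ /(refutes_find dsfF')] [|W [F'W Wg no]].
    by move=> c; rewrite mem_filter => /andP[pc ct]; apply/pE.
  have /sub/FE [c ct Wc] := F'W.
  apply: (no c); last by apply: emb_trans Wg; apply/iso_emb/iso_sym.
  by rewrite mem_filter ct andbT; apply/pE => //; apply: gset_iso Wc F'W.
case: t sz pw FE {t_in dsft min_t} => [|a [|b [|c []]]] //= _.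
case/and3P=> /and3P[ab ac _] /andP[bc _] _ FE.
have nc p q : ~~ ciso p q -> ~ iso (cgraph p) (cgraph q).
  by move/negP=> npq /cisoP.
exists (cgraph a), (cgraph b), (cgraph c); split; try exact: nc.
move=> G; rewrite FE; split=> [[d]|[]Gd]; last 3 first.
- by exists a; rewrite ?inE ?eqxx.
- by exists b; rewrite ?inE ?eqxx ?orbT.
- by exists c; rewrite ?inE ?eqxx ?orbT.
by rewrite !inE => /or3P[] /eqP-> Gd; [constructor 1|constructor 2|constructor 3].
Qed.

(** * Codes of the named graphs *)

Lemma triple_cset X Y Z a b c F :
    iso X (cgraph a) -> iso Y (cgraph b) -> iso Z (cgraph c) ->
  gset_eq F (triple X Y Z) <-> gset_eq F (cset [:: a; b; c]).
Proof.
move=> Xa Yb Zc; suff E G : triple X Y Z G <-> cset [:: a; b; c] G.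
  by split=> FE G; rewrite FE E.
split=> [[]|[d]].
- by move=> GX; exists a; rewrite ?inE ?eqxx //; apply: iso_trans GX Xa.
- by move=> GY; exists b; rewrite ?inE ?eqxx ?orbT //; apply: iso_trans GY Yb.
- by move=> GZ; exists c; rewrite ?inE ?eqxx ?orbT //; apply: iso_trans GZ Zc.
rewrite !inE => /or3P[] /eqP-> Gd; [constructor 1|constructor 2|constructor 3].
- exact: iso_trans Gd (iso_sym Xa).
- exact: iso_trans Gd (iso_sym Yb).
- exact: iso_trans Gd (iso_sym Zc).
Qed.

(** The boolean hypothesis is closed by evaluation once the vertices are listed in the order of the
    code; the cardinality bound makes the listing complete. *)
Lemma iso_listing (G : sgraph) c (x0 : G) (s : seq G) :
    [&& uniq s, size s == size c &
        all (fun i => all (fun j =>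
          sedge (nth x0 s i) (nth x0 s j) == adj c i j) (iota 0 (size c)))
          (iota 0 (size c))] ->
    #|G| <= size c -> iso G (cgraph c).
Proof.
case/and3P=> s_uniq /eqP sz /allP chk leGc; apply/iso_sym/emb_iso; last first.
  by rewrite card_ord.
exists (fun i : cgraph c => nth x0 s (i : 'I__)) => [i j /eqP|i j].
  by rewrite nth_uniq ?sz // => /eqP/val_inj.
have := chk i; rewrite mem_iota ltn_ord => /(_ isT)/allP/(_ j).
by rewrite mem_iota ltn_ord => /(_ isT)/eqP.
Qed.

Local Notation ord n i := (@Ordinal n i isT).

Lemma iso_K3 : iso (K 3) (cgraph code_k3).
Proof.
by apply: (@iso_listing (K 3) _ (ord 3 0) [:: (ord 3 0); (ord 3 1);
    (ord 3 2)]); rewrite ?card_ord.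
Qed.

Lemma iso_KB13 : iso (KB 1 3) (cgraph code_k13).
Proof.
apply: (@iso_listing (KB 1 3) _ (inl (ord 1 0)) [:: inl (ord 1 0);
    inr (ord 3 0); inr (ord 3 1); inr (ord 3 2)]).
  by [].
by rewrite card_sum !card_ord.
Qed.

Lemma iso_KB23 : iso (KB 2 3) (cgraph code_k23).
Proof.
apply: (@iso_listing (KB 2 3) _ (inl (ord 2 0))
  [:: inl (ord 2 0); inl (ord 2 1); inr (ord 3 0); inr (ord 3 1); inr (ord 3 2)]) => //.
by rewrite card_sum !card_ord.
Qed.

Lemma iso_C4 : iso (C 4) (cgraph code_c4).
Proof.
by apply: (@iso_listing (C 4) _ (ord 4 0) [:: (ord 4 0); (ord 4 1); (ord 4 2);
    (ord 4 3)]); rewrite ?card_ord.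
Qed.

Lemma iso_2K2 : iso (2 * K 2)%G (cgraph code_2k2).
Proof.
apply: (@iso_listing (2 * K 2)%G _ (ord 2 0, ord 2 0)
  [:: (ord 2 0, ord 2 0); (ord 2 0, ord 2 1); (ord 2 1, ord 2 0);
      (ord 2 1, ord 2 1)]) => //.
by rewrite card_prod !card_ord.
Qed.

Lemma iso_P3K1 : iso (P 3 + K 1)%G (cgraph code_p3k1).
Proof.
apply: (@iso_listing (P 3 + K 1)%G _ (inr (ord 1 0))
  [:: inl (ord 3 0); inl (ord 3 1); inl (ord 3 2); inr (ord 1 0)]) => //.
by rewrite card_sum !card_ord.
Qed.

Lemma iso_K3K1 : iso (K 3 + K 1)%G (cgraph code_k3k1).
Proof.
apply: (@iso_listing (K 3 + K 1)%G _ (inr (ord 1 0))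
  [:: inl (ord 3 0); inl (ord 3 1); inl (ord 3 2); inr (ord 1 0)]) => //.
by rewrite card_sum !card_ord.
Qed.

Lemma iso_3K1 : iso (3 * K 1)%G (cgraph (ccompl code_k3)).
Proof.
apply: (@iso_listing (3 * K 1)%G _ (ord 3 0, ord 1 0)
  [:: (ord 3 0, ord 1 0); (ord 3 1, ord 1 0); (ord 3 2, ord 1 0)]) => //.
by rewrite card_prod !card_ord.
Qed.

Lemma iso_K1K3 : iso (K 1 + K 3)%G (cgraph (ccompl code_k13)).
Proof.
apply: (@iso_listing (K 1 + K 3)%G _ (inl (ord 1 0))
  [:: inl (ord 1 0); inr (ord 3 0); inr (ord 3 1); inr (ord 3 2)]) => //.
by rewrite card_sum !card_ord.
Qed.

Lemma iso_K2K3 : iso (K 2 + K 3)%G (cgraph (ccompl code_k23)).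
Proof.
apply: (@iso_listing (K 2 + K 3)%G _ (inl (ord 2 0))
  [:: inl (ord 2 0); inl (ord 2 1); inr (ord 3 0); inr (ord 3 1); inr (ord 3 2)]) => //.
by rewrite card_sum !card_ord.
Qed.

Lemma iso_C4_compl : iso (C 4) (cgraph (ccompl code_2k2)).
Proof.
(* The non-edges of [C 4] are 02 and 13, which must come in the places of the two edges of
   [code_2k2]. *)
by apply: (@iso_listing (C 4) _ (ord 4 0) [:: (ord 4 0); (ord 4 2); (ord 4 1);
    (ord 4 3)]); rewrite ?card_ord.
Qed.

Lemma iso_2K2_compl : iso (2 * K 2)%G (cgraph (ccompl code_c4)).
Proof.
apply: (@iso_listing (2 * K 2)%G _ (ord 2 0, ord 2 0)
  [:: (ord 2 0, ord 2 0); (ord 2 1, ord 2 0); (ord 2 0, ord 2 1);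
      (ord 2 1, ord 2 1)]) => //.
by rewrite card_prod !card_ord.
Qed.

Lemma iso_KB13_compl : iso (KB 1 3) (cgraph (ccompl code_k3k1)).
Proof.
apply: (@iso_listing (KB 1 3) _ (inl (ord 1 0))
  [:: inr (ord 3 0); inr (ord 3 1); inr (ord 3 2); inl (ord 1 0)]) => //.
by rewrite card_sum !card_ord.
Qed.

Lemma iso_paw : iso paw (cgraph (ccompl code_p3k1)).
Proof.
apply: iso_trans (complement_iso iso_P3K1) _.
exact/iso_sym/ccompl_iso.
Qed.

Local Open Scope graph_scope.

Theorem theorem3p13 (F : graph_set) :
  minimal_DSF_triple F <->
     gset_eq F (triple (K 3) (KB 1 3) (2 * K 2))
  \/ gset_eq F (triple (K 3) (KB 1 3) (P 3 + K 1))
  \/ gset_eq F (triple (K 3) (KB 2 3) (P 3 + K 1))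
  \/ gset_eq F (triple (K 3) (C 4) (P 3 + K 1))
  \/ gset_eq F (triple (K 3 + K 1) (C 4) (P 3 + K 1))
  \/ gset_eq F (triple (3 * K 1) (K 1 + K 3) (C 4))
  \/ gset_eq F (triple (3 * K 1) (K 1 + K 3) paw)
  \/ gset_eq F (triple (3 * K 1) (K 2 + K 3) paw)
  \/ gset_eq F (triple (3 * K 1) (2 * K 2) paw)
  \/ gset_eq F (triple (KB 1 3) (2 * K 2) paw).
Proof.
rewrite (triple_cset _ iso_K3 iso_KB13 iso_2K2)
  (triple_cset _ iso_K3 iso_KB13 iso_P3K1)
  (triple_cset _ iso_K3 iso_KB23 iso_P3K1)
  (triple_cset _ iso_K3 iso_C4 iso_P3K1)
  (triple_cset _ iso_K3K1 iso_C4 iso_P3K1)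
  (triple_cset _ iso_3K1 iso_K1K3 iso_C4_compl)
  (triple_cset _ iso_3K1 iso_K1K3 iso_paw)
  (triple_cset _ iso_3K1 iso_K2K3 iso_paw)
  (triple_cset _ iso_3K1 iso_2K2_compl iso_paw)
  (triple_cset _ iso_KB13_compl iso_2K2_compl iso_paw).
have in_cons := @mem_head; split=> [[Fmin F3]|].
  have [t + FE] := classification Fmin F3.
  rewrite !inE; do 9!(case/orP=> [/eqP tE|]; first by rewrite tE in FE; tauto).
  by move/eqP=> tE; rewrite tE in FE; tauto.
do 9!(case=> [|]; first by apply: forcing_triple_minimal; rewrite !inE eqxx ?orbT).
by apply: forcing_triple_minimal; rewrite !inE eqxx ?orbT.
Qed.
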